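(* Let $k\ge1$ and let $V$ be a complex vector space of dimension $n\ge 2k$ (stable rank). The representation $S^{k}_{0}\mathfrak{sl}(V)$ of $SL(V)$ decomposes as the direct sum of irreducible representations with highest weights $\lambda-w(\lambda)$ for $\lambda\in \mathrm{Par}(k)$ (each occurring once), where $w$ is the longest element of the Weyl group of $SL(V)$.
   Context: $\mathfrak{gl}(V)\cong V\otimes V^*$, and $\mathfrak{sl}(V)$ is its trace-free part. $S^k_0\mathfrak{sl}(V)$ is the totally trace-free part of the $k$-th symmetric power of $\mathfrak{sl}(V)$: the subspace of those elements of $S^k\mathfrak{sl}(V)\subset(\bigotimes^kV)\otimes(\bigotimes^kV^* )$ for which every contraction of a $V$-index with a $V^*$-index vanishes. $\mathrm{Par}(k)$ is the set of partitions of $k$. A partition $\lambda=(\lambda_1\ge\lambda_2\ge\dots)$ is regarded as the weight $\sum_i\lambda_i\epsilon_i$, where $\epsilon_1,\dots,\epsilon_n$ are the standard weights of $V$; $w$ acts by $\epsilon_i\mapsto\epsilon_{n+1-i}$. *)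

(* Defs.v *)
From HB Require Import structures.
From mathcomp Require Import all_boot all_order all_fingroup all_algebra.

Set Implicit Arguments.
Unset Strict Implicit.
Unset Printing Implicit Defensive.

Import GRing.Theory.
Local Open Scope ring_scope.

(* V is F^n with its standard basis e_1, .., e_n (indexed by 'I_n from 0).    *)
(* An element T of (V^(x)k) (x) (V^* (x)k) is given by its coordinates        *)
(* T (a, b), with a the multi-index of the V-slots and b that of the          *)
(* V^*-slots.                                                                 *)

Definition mindex (n k : nat) : finType := {ffun 'I_k -> 'I_n}.

Definition tensor (F : fieldType) (n k : nat) : vectType F :=
  {ffun mindex n k * mindex n k -> F^o}.

(* gl(V) = V (x) V^*, so the pure tensor A_1 (x) .. (x) A_k of k matrices is  *)
(* an element of (V^(x)k) (x) (V^* (x)k).                                     *)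
Definition ptensor (F : fieldType) (n k : nat) (A : 'I_k -> 'M[F]_n) :
    tensor F n k :=
  [ffun ab : mindex n k * mindex n k => \prod_p A p (ab.1 p) (ab.2 p)].

(* The action of g on V and, contragrediently, on V^*: on gl(V) it is         *)
(* X |-> g X g^-1.                                                            *)
Definition SL_act_fun (F : fieldType) (n k : nat) (g : 'M[F]_n)
    (T : tensor F n k) : tensor F n k :=
  [ffun ab : mindex n k * mindex n k =>
     \sum_(c : mindex n k) \sum_(d : mindex n k)
        (\prod_p g (ab.1 p) (c p)) * (\prod_p invmx g (d p) (ab.2 p))
        * T (c, d)].

Definition perm_fun (F : fieldType) (n k : nat) (s : 'S_k)
    (T : tensor F n k) : tensor F n k :=
  [ffun ab : mindex n k * mindex n k =>
     T ([ffun p => ab.1 (s p)], [ffun p => ab.2 (s p)])].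

Definition insert_index (n k : nat) (p : 'I_k) (x : 'I_n)
    (a : mindex n k.-1) : mindex n k :=
  [ffun r => if unlift p r is Some r' then a r' else x].

Definition contract_fun (F : fieldType) (n k : nat) (p q : 'I_k)
    (T : tensor F n k) : tensor F n k.-1 :=
  [ffun ab : mindex n k.-1 * mindex n k.-1 =>
     \sum_x T (insert_index p x ab.1, insert_index q x ab.2)].

Fact SL_act_fun_linear (F : fieldType) n k (g : 'M[F]_n) :
  linear (@SL_act_fun F n k g).
Proof.
move=> c T U; apply/ffunP=> ab; rewrite !ffunE /= scaler_sumr -big_split.
apply: eq_bigr => i _; rewrite scaler_sumr -big_split /=.
by apply: eq_bigr => j _; rewrite !ffunE mulrDr scalerAr.
Qed.
HB.instance Definition _ (F : fieldType) n k (g : 'M[F]_n) :=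
  GRing.isLinear.Build F (tensor F n k) (tensor F n k) *:%R
    (@SL_act_fun F n k g) (@SL_act_fun_linear F n k g).

Fact perm_fun_linear (F : fieldType) n k (s : 'S_k) : linear (@perm_fun F n k s).
Proof. by move=> c T U; apply/ffunP=> ab; rewrite !ffunE. Qed.
HB.instance Definition _ (F : fieldType) n k (s : 'S_k) :=
  GRing.isLinear.Build F (tensor F n k) (tensor F n k) *:%R
    (@perm_fun F n k s) (@perm_fun_linear F n k s).

Fact contract_fun_linear (F : fieldType) n k (p q : 'I_k) :
  linear (@contract_fun F n k p q).
Proof.
move=> c T U; apply/ffunP=> ab; rewrite !ffunE /= scaler_sumr -big_split.
by apply: eq_bigr => i _; rewrite !ffunE.
Qed.
HB.instance Definition _ (F : fieldType) n k (p q : 'I_k) :=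
  GRing.isLinear.Build F (tensor F n k) (tensor F n k.-1) *:%R
    (@contract_fun F n k p q) (@contract_fun_linear F n k p q).

Definition SL_act (F : fieldType) (n k : nat) (g : 'M[F]_n) :
  'End(tensor F n k) := linfun (@SL_act_fun F n k g).

Definition perm_slots (F : fieldType) (n k : nat) (s : 'S_k) :
  'End(tensor F n k) := linfun (@perm_fun F n k s).

Definition contract (F : fieldType) (n k : nat) (p q : 'I_k) :
  'Hom(tensor F n k, tensor F n k.-1) := linfun (@contract_fun F n k p q).

Definition trace_fun (F : fieldType) (n : nat) (A : 'M[F]_n) : F^o := \tr A.
Fact trace_fun_linear (F : fieldType) n : linear (@trace_fun F n).
Proof. by move=> c A B; rewrite /trace_fun linearP. Qed.
HB.instance Definition _ (F : fieldType) n :=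
  GRing.isLinear.Build F 'M[F]_n F^o *:%R
    (@trace_fun F n) (@trace_fun_linear F n).

Definition sl (F : fieldType) (n : nat) : {vspace 'M[F]_n} :=
  lker (linfun (@trace_fun F n)).

Definition tensor_power (F : fieldType) (n k : nat) (U : {vspace 'M[F]_n}) :
    {vspace tensor F n k} :=
  <<[seq ptensor (fun p => (vbasis U)`_(f p))
       | f : {ffun 'I_k -> 'I_(\dim U)}]>>%VS.

(* In characteristic 0 the symmetric power is the space of symmetric tensors. *)
Definition sym_power (F : fieldType) (n k : nat) (U : {vspace 'M[F]_n}) :
    {vspace tensor F n k} :=
  (tensor_power k U :&: \bigcap_(s : 'S_k) fixedSpace (perm_slots F n s))%VS.

Definition S0sl (F : fieldType) (n k : nat) : {vspace tensor F n k} :=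
  (sym_power k (sl F n)
   :&: \bigcap_(p < k) \bigcap_(q < k) lker (contract F n p q))%VS.

Definition SL_stable (F : fieldType) (n k : nat) (W : {vspace tensor F n k}) :
    Prop :=
  forall g : 'M[F]_n, \det g = 1 -> (SL_act k g @: W <= W)%VS.

Definition SL_irreducible (F : fieldType) (n k : nat)
    (W : {vspace tensor F n k}) : Prop :=
  [/\ SL_stable W, W != 0%VS
    & forall U : {vspace tensor F n k},
        SL_stable U -> (U <= W)%VS -> U = 0%VS \/ U = W].

(* The weight \sum_i mu_i eps_i, that is the character                        *)
(* diag(t_1, .., t_n) |-> \prod_i t_i ^ mu_i of the maximal torus.            *)
Definition weight (n : nat) := 'rV[int]_n.

Definition weight_char (F : fieldType) (n : nat) (mu : weight n)
    (t : 'rV[F]_n) : F := \prod_i t 0 i ^ mu 0 i.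

Definition upper_unitriangular (F : fieldType) (n : nat) (g : 'M[F]_n) : Prop :=
  forall i j : 'I_n, (j <= i)%N -> g i j = (i == j)%:R.

(* Highest weights are taken with respect to the diagonal torus of SL(V) and  *)
(* the Borel subgroup of upper triangular matrices.                           *)
Definition highest_weight_vector (F : fieldType) (n k : nat) (mu : weight n)
    (v : tensor F n k) : Prop :=
  [/\ v != 0,
      forall g : 'M[F]_n, upper_unitriangular g -> SL_act k g v = v
    & forall t : 'rV[F]_n, \prod_i t 0 i = 1 ->
        SL_act k (diag_mx t) v = weight_char mu t *: v].

Definition irreducible_of_highest_weight (F : fieldType) (n k : nat)
    (mu : weight n) (W : {vspace tensor F n k}) : Prop :=
  SL_irreducible W /\ exists2 v, v \in W & highest_weight_vector mu v.

(* A partition of k has at most k parts, each at most k; it is padded with    *)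
(* zeros to length k.                                                         *)
Definition is_partition (k : nat) (l : k.-tuple 'I_k.+1) : bool :=
  sorted geq [seq val x | x <- l] && (\sum_(x <- l) val x == k)%N.

Definition Par (k : nat) : finType := {l : k.-tuple 'I_k.+1 | is_partition l}.

Definition part_weight (n k : nat) (l : Par k) : weight n :=
  \row_(i < n) (nth 0%N [seq nat_of_ord x | x <- val l] i)%:Z.

(* The longest Weyl group element, eps_i |-> eps_(n+1-i).                     *)
Definition w0 (n : nat) (mu : weight n) : weight n :=
  \row_(i < n) mu 0 (rev_ord i).

(* Main.v *)
From HB Require Import structures.
From Stdlib Require Import Classical.
Require Import Defs.
From mathcomp Require Import all_boot all_order all_fingroup all_algebra.
From mathcomp Require Import ring.
From mathcomp Require Import reals complex.

Set Implicit Arguments.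
Unset Strict Implicit.
Unset Printing Implicit Defensive.

Import Order.TTheory GRing.Theory Num.Theory.

(** Elements of [S0sl] are the tensors that are invariant under simultaneous
    permutations of the slots and killed by all contractions
    ([mem_S0sl]).  The proof produces as many orthogonal irreducible pieces as
    there are partitions of k and shows that there is no room for more.

    Lower bound.  Fill the diagram of l with the k slots, and let w be the
    tensor product of the column-antisymmetrisation of the e_(row of p) with the
    column-antisymmetrisation of the dual vectors e*_(n+1-row of p).  Read as a
    polynomial on matrices, the sum [hw_vector] of all slot permutations of w
    is, up to a factor, a product of corner minors, one for each column.  It is an
    eigenvector of every upper triangular matrix ([upper_hw_vector]), and its
    contractions vanish because its two index ranges, the k first and the k
    last indices, are disjoint; this is where n >= 2k is used.  The GL-orbits of
    the vectors of different partitions are orthogonal for the standard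
    hermitian form: on a product L U of triangular matrices the
    pairing reduces to that of the vectors themselves, which have different
    weights, and such products are dense ([big_cell_dense],
    [hw_orbits_orthogonal]).

    Upper bound.  An orthogonal family of nonzero stable subspaces of [S0sl]
    gives linearly independent projections that commute with GL(V).  Moving the
    dual slots to the other side, an endomorphism commuting with GL(V) becomes an
    endomorphism of the 2k-th tensor power of V commuting with GL(V), hence, as
    2k <= n, a combination of permutations of the 2k slots ([stable_FFT],
    [kernel_brauer]).  In the original picture a permutation that mixes
    the two kinds of slots starts with a contraction and dies on
    [S0sl] ([brauer_term_cap]); any other one moves the upper slots relative to
    the lower ones by some t in S_k ([brauer_term_block]).  As the values are
    symmetric, the coefficient of t may be averaged over its conjugacy class.  So
    the projections live in a space of dimension at most the number of
    cycle types, that is of partitions of k ([commutant_class_expansion],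
    [orthogonal_family_bound]).

    Conclusion.  The spans of the orbits of the [hw_vector]s already reach the
    bound.  Since orthogonal complements of stable subspaces are stable
    ([perp_stable]), a proper nonzero stable subspace of one span, or a vector of
    [S0sl] outside their sum, would give a longer orthogonal family
    ([no_further_summand]). *)

(** * Cycle types and conjugacy in the symmetric group *)

Section CycleType.
Variable k : nat.
Implicit Types s t : 'S_k.

Definition longer (c d : seq 'I_k) := (size d <= size c)%N.

(** The cycles are listed by decreasing length so that the list of their lengths
    is a partition. *)
Definition cycles s : seq (seq 'I_k) :=
  sort longer [seq fingraph.orbit s x | x <- enum 'I_k & froot s x == x].

Lemma mem_flatten_cycles s x : x \in flatten (cycles s).
Proof.
apply/flattenP; exists (fingraph.orbit s (froot s x)).
  rewrite mem_sort; apply/map_f; rewrite mem_filter mem_enum andbT.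
  by rewrite root_root //; apply: fconnect_sym; apply: perm_inj.
rewrite -fconnect_orbit fconnect_sym ?connect_root //; exact: perm_inj.
Qed.

Lemma uniq_flatten_cycles s : uniq (flatten (cycles s)).
Proof.
rewrite (perm_uniq (perm_flatten (permEl (perm_sort _ _)))).
have sym := fconnect_sym (@perm_inj _ s).
set r := [seq x <- enum 'I_k | froot s x == x].
rewrite (eq_map (g := fun x => [seq y | y <- fingraph.orbit s x])); last by move=> x; rewrite map_id.
apply: (@allpairs_uniq_dep _ _ _ (fun _ y => y)) => [|x _|].
- by rewrite filter_uniq ?enum_uniq.
- exact: orbit_uniq.
move=> _ _ /allpairsPdep[x [y [xr yx ->]]] /allpairsPdep[x' [y' [xr' yx' ->]]] /= yy.
case: _ / yy in yx' *.
move: xr xr' yx yx'; rewrite !mem_filter -!fconnect_orbit.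
move=> /andP[/eqP xr _] /andP[/eqP xr' _] yx yx'.
suff -> : x = x' by [].
rewrite -xr -xr'; apply/eqP; rewrite root_connect //.
by apply: connect_trans yx _; rewrite sym.
Qed.

Lemma fcycle_cycles s c : c \in cycles s -> fcycle s c.
Proof.
by rewrite mem_sort => /mapP[x _ ->]; apply/cycle_orbit/perm_inj.
Qed.

(** Write down the cycles of [s] and of [t] one below the other: since the
    lengths agree, matching the entries at the same place is a bijection that
    carries cycles to cycles, and so conjugates [s] into [t]. *)
Lemma same_shape_conj s t : shape (cycles s) = shape (cycles t) ->
  exists g : 'S_k, forall x, g (s x) = t (g x).
Proof.
move=> sh.
pose L s := flatten (cycles s).
have Lsize s' : size (L s') = k.
  rewrite -[RHS]card_ord cardE; apply: perm_size; apply: uniq_perm.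
  - exact: uniq_flatten_cycles.
  - exact: enum_uniq.
  by move=> x; rewrite mem_flatten_cycles mem_enum.
pose g0 x := nth x (L t) (index x (L s)).
have g0_inj : injective g0.
  move=> x y; rewrite /g0 (set_nth_default x) ?Lsize; last first.
    by rewrite -[X in (_ < X)%N](Lsize s) index_mem mem_flatten_cycles.
  move/eqP; rewrite nth_uniq ?uniq_flatten_cycles //; last first.
  - by rewrite Lsize -[X in (_ < X)%N](Lsize s) index_mem mem_flatten_cycles.
  - by rewrite Lsize -[X in (_ < X)%N](Lsize s) index_mem mem_flatten_cycles.
  by move/eqP/index_inj; apply; rewrite ?mem_flatten_cycles.
have gL : [seq g0 x | x <- L s] = L t.
  case: (posnP k) => [k0|k_gt0].
    have L0 s' : L s' = [::] by apply: size0nil; rewrite Lsize.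
    by rewrite !L0.
  pose x0 := Ordinal k_gt0.
  apply: (@eq_from_nth _ x0); first by rewrite size_map !Lsize.
  move=> i; rewrite size_map => iL; rewrite (nth_map x0) // /g0.
  by rewrite index_uniq ?uniq_flatten_cycles //; apply: set_nth_default; rewrite Lsize -(Lsize s).
exists (perm g0_inj) => x; rewrite !permE.
have gc : [seq [seq g0 x | x <- c] | c <- cycles s] = cycles t.
  rewrite -[LHS]flattenK -map_flatten -/(L s) gL -[RHS]flattenK -sh; congr reshape.
  by rewrite /shape -map_comp; apply: eq_map => c; rewrite /= size_map.
have [c cs xc] : exists2 c, c \in cycles s & x \in c.
  exact/flattenP/mem_flatten_cycles.
have uc : uniq c.
  have := uniq_flatten_cycles s; case/splitPr: cs => c1 c2.
  by rewrite flatten_cat /= !cat_uniq => /and5P[].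
have /eqP -> := next_cycle (fcycle_cycles cs) xc.
rewrite -(next_map g0_inj) //; apply/esym/eqP.
apply: (@next_cycle _ (frel t)); last exact: map_f.
by apply: fcycle_cycles; rewrite -gc map_f.
Qed.

(** Elements of [Par k] are sequences of length exactly [k]. *)
Definition padded_shape s : seq nat :=
  shape (cycles s) ++ nseq (k - size (cycles s)) 0.

Lemma sumn_shape_cycles s : sumn (shape (cycles s)) = k.
Proof.
rewrite -size_flatten -[RHS]card_ord cardE; apply: perm_size; apply: uniq_perm.
- exact: uniq_flatten_cycles.
- exact: enum_uniq.
by move=> x; rewrite mem_flatten_cycles mem_enum.
Qed.

Lemma shape_cycles_gt0 s : all (leq 1) (shape (cycles s)).
Proof.
rewrite all_map; apply/allP => c; rewrite mem_sort => /mapP[x _ ->] /=.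
by rewrite size_orbit fingraph.order_gt0.
Qed.

Lemma size_leq_sumn (sh : seq nat) : all (leq 1) sh -> size sh <= sumn sh.
Proof.
by elim: sh => //= m sh IH /andP[m0 /IH]; rewrite -add1n; apply: leq_add.
Qed.

Lemma size_padded_shape s : size (padded_shape s) = k.
Proof.
rewrite size_cat size_nseq size_map subnKC //.
rewrite -(size_map size) -[X in _ <= X](sumn_shape_cycles s).
exact/size_leq_sumn/shape_cycles_gt0.
Qed.

Lemma sumn_padded_shape s : sumn (padded_shape s) = k.
Proof. by rewrite sumn_cat sumn_nseq mul0n addn0 sumn_shape_cycles. Qed.

Definition cycle_type_tuple s : k.-tuple 'I_k.+1 :=
  [tuple inord (nth 0 (padded_shape s) i) | i < k].

Lemma nth_leq_sumn (sh : seq nat) i : nth 0 sh i <= sumn sh.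
Proof.
elim: sh i => [|m sh IH] [|i] //=; first exact: leq_addr.
exact: leq_trans (IH i) (leq_addl _ _).
Qed.

Lemma cycle_type_tupleE s : [seq val x | x <- cycle_type_tuple s] = padded_shape s.
Proof.
apply: (@eq_from_nth _ 0); rewrite size_map size_tuple ?size_padded_shape // => i ik.
rewrite (nth_map ord0) ?size_tuple // -[ i ]/(val (Ordinal ik)) -tnth_nth tnth_mktuple /=.
by rewrite inordK // ltnS -[X in _ <= X](sumn_padded_shape s) nth_leq_sumn.
Qed.

Lemma cycle_type_partition s : is_partition (cycle_type_tuple s).
Proof.
rewrite /is_partition cycle_type_tupleE; apply/andP; split.
  rewrite sorted_pairwise; last by move=> m n p nm mp; apply: leq_trans mp nm.
  rewrite pairwise_cat -!sorted_pairwise; try by move=> m n p nm mp; apply: leq_trans mp nm.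
  apply/and3P; split.
  - by apply/allrelP => m n _ /nseqP[-> _].
  - rewrite sorted_map; apply: sort_sorted => c d; exact: leq_total.
  - by elim: (k - _) => //= -[|m].
by rewrite -(big_map val predT id) cycle_type_tupleE -sumnE sumn_padded_shape.
Qed.

Definition cycle_type s : Par k := Sub (cycle_type_tuple s) (cycle_type_partition s).

(** The padding zeros can be recognised because every cycle is nonempty. *)
Lemma cycle_type_conj s t : cycle_type s = cycle_type t ->
  exists g : 'S_k, forall x, g (s x) = t (g x).
Proof.
move=> /(congr1 val)/(congr1 (fun l : k.-tuple 'I_k.+1 => [seq val x | x <- l])).
rewrite /= !cycle_type_tupleE => /(congr1 (filter (leq 1))).
have E u : filter (leq 1) (padded_shape u) = shape (cycles u).
  rewrite filter_cat (all_filterP (shape_cycles_gt0 u)).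
  by rewrite (eq_in_filter (a2 := pred0)) ?filter_pred0 ?cats0 // => m /nseqP[->].
by rewrite !E; apply: same_shape_conj.
Qed.

End CycleType.

Local Open Scope ring_scope.

(** * Density of the big cell of the general linear group *)

Section Density.
Variable F : numFieldType.

Local Notation evalmx s A := (map_mx (horner_eval s) A).

Lemma poly_eq0_ev (p : {poly F}) : (forall s, p.[s] = 0) -> p = 0.
Proof.
move=> p0; apply: contraTeq isT => p_neq0.
have := @max_poly_roots _ p [seq i%:R | i <- iota 0 (size p)] p_neq0.
rewrite size_map size_iota ltnn => H; apply/H.
  by apply/allP=> x _; rewrite /root p0.
by rewrite map_inj_uniq ?iota_uniq // => i j /eqP; rewrite eqr_nat => /eqP.
Qed.

(** Induction on the size.  The Schur complement of the top left entry [a] is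
    made polynomial by multiplying it by [a], and it is again the identity at 0;
    the exceptional parameters are the zeros of the pivots met on the way. *)
Lemma LU_generic n (A : 'M[{poly F}]_n) :
  evalmx 0 A = 1%:M ->
  exists2 q : {poly F}, q != 0 & forall s, q.[s] != 0 ->
    exists L U : 'M[F]_n,
      [/\ is_trig_mx L, is_trig_mx U^T, L \in unitmx, U \in unitmx
        & evalmx s A = L *m U].
Proof.
elim: n A => [|n IHn] A A1.
  exists 1 => [|s _]; first exact: oner_neq0.
  exists 1%:M, 1%:M; split; rewrite ?unitmx1 ?tr_scalar_mx ?scalar_mx_is_trig //.
  by apply/matrixP => -[].
pose A' : 'M_(1 + n) := A.
pose a := A' 0 0; pose D := drsubmx A'; pose r := ursubmx A'.
pose c := dlsubmx A'.
have AE : A' = block_mx a%:M r c D.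
  rewrite -[LHS]submxK; congr block_mx.
  by apply/matrixP=> i j; rewrite !ord1 !mxE mulr1n /a; congr (A' _ _); apply: val_inj.
have evA s : evalmx s A = block_mx a.[s]%:M (evalmx s r) (evalmx s c) (evalmx s D) :> 'M_(1 + n).
  transitivity (evalmx s (block_mx a%:M r c D)); first by rewrite -AE.
  rewrite map_block_mx /=; congr block_mx.
  by apply/matrixP=> i j; rewrite !ord1 !mxE eqxx !mulr1n.
have [] : [/\ a.[0] = 1, evalmx 0 c = 0 & evalmx 0 D = 1%:M].
  move: A1; rewrite evA (@scalar_mx_block F 1 n 1).
  case/(@eq_block_mx F 1 n 1 n) => /matrixP/(_ 0 0); rewrite !mxE eqxx !mulr1n.
  by move=> a1 _ c0 D1; split.
move=> a1 c0 D1.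
pose B := a *: D - c *m r.
have evB s : evalmx s B = a.[s] *: evalmx s D - evalmx s c *m evalmx s r.
  by rewrite /B map_mxB map_mxM map_mxZ.
have [|q q0 qP] := IHn B.
  by rewrite evB a1 c0 D1 mul0mx subr0 scale1r.
exists (a * q) => [|s].
  rewrite mulf_neq0 //; apply: contra_eq_neq a1 => ->.
  by rewrite horner0 eq_sym oner_eq0.
rewrite hornerM mulf_eq0 negb_or => /andP[as0 /qP[L [U [Lt Ut Lu Uu BE]]]].
exists (block_mx 1%:M 0 (a.[s]^-1 *: evalmx s c) L : 'M_(1 + n)).
exists (block_mx a.[s]%:M (evalmx s r) 0 (a.[s]^-1 *: U) : 'M_(1 + n)).
split.
- rewrite (@is_trig_block_mx F 1 n 1 n) // eqxx mx11_is_trig Lt //.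
- rewrite (@tr_block_mx F 1 n 1 n) (@is_trig_block_mx F 1 n 1 n) // trmx0 eqxx mx11_is_trig /=.
  rewrite linearZ /=; apply/is_trig_mxP => i j ij; rewrite mxE.
  by rewrite (is_trig_mxP Ut) ?mulr0.
- by rewrite unitmxE (@det_lblock F 1 n) det1 mul1r -unitmxE.
- rewrite unitmxE (@det_ublock F 1 n) unitrM det_scalar1 unitfE as0 /= -unitmxE.
  by rewrite unitmxZ ?unitfE ?invr_eq0.
rewrite evA (@mulmx_block F 1 n 1 n 1 n) !mul1mx !mul0mx !mulmx0 !addr0.
apply: (f_equal4 (@block_mx F 1 n 1 n)) => //.
  by rewrite mul_mx_scalar scalerA mulfV ?scale1r.
rewrite -scalemxAl -scalemxAr -BE evB scalerBr scalerA mulVf // scale1r.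
by rewrite addrC subrK.
Qed.

(** Polynomial functions are handled as pairs of a function [f] on scalar matrices
    and its lift [P] to matrices of polynomials.  On the line joining 1 to [g] all
    but finitely many points have a triangular factorisation, so [f] vanishes
    on the line, in particular at [g]. *)
Lemma big_cell_dense n (f : 'M[F]_n -> F) (P : 'M[{poly F}]_n -> {poly F}) :
  (forall A s, (P A).[s] = f (evalmx s A)) ->
  (forall L U : 'M[F]_n, is_trig_mx L -> is_trig_mx U^T ->
     L \in unitmx -> U \in unitmx -> f (L *m U) = 0) ->
  forall g, f g = 0.
Proof.
move=> fP f0 g.
pose A : 'M[{poly F}]_n := 1%:M + 'X *: map_mx polyC (g - 1%:M).
have evA s : evalmx s A = 1%:M + s *: (g - 1%:M).
  apply/matrixP=> i j; rewrite !mxE /horner_eval !(hornerE, hornerMn).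
  by case: eqP => _; rewrite ?hornerE /=.
have [|q q0 qP] := @LU_generic n A; first by rewrite evA scale0r addr0.
have /eqP : P A * q = 0.
  apply: poly_eq0_ev => s; rewrite hornerM.
  have [->|/qP [L [U [Lt Ut Lu Uu AE]]]] := eqVneq q.[s] 0; first by rewrite mulr0.
  by rewrite fP AE f0 ?mul0r.
rewrite mulf_eq0 (negPf q0) orbF => /eqP PA0.
by have := fP A 1; rewrite PA0 horner0 evA scale1r addrC subrK.
Qed.

End Density.

(** * Tensor powers of a matrix and the first fundamental theorem *)

Section Tpow.

(** Matrix coefficients of the tensor power of [g] indexed by the slots [I]. *)
Definition tpow (R : comPzRingType) (I : finType) n (g : 'M[R]_n)
  (a b : {ffun I -> 'I_n}) : R := \prod_p g (a p) (b p).

Lemma tpowM (R : comPzRingType) (I : finType) n (g h : 'M[R]_n)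
    (a b : {ffun I -> 'I_n}) :
  \sum_c tpow g a c * tpow h c b = tpow (g *m h) a b.
Proof.
transitivity (\prod_p \sum_x g (a p) x * h x (b p)).
  by rewrite bigA_distr_bigA; apply: eq_bigr => c _; rewrite big_split.
by apply: eq_bigr => p _; rewrite mxE.
Qed.

Lemma tpow1 (R : comPzRingType) (I : finType) n (a b : {ffun I -> 'I_n}) :
  tpow (1%:M : 'M[R]_n) a b = (a == b)%:R.
Proof.
have [->|neq] := eqVneq a b; first by rewrite /tpow big1 // => p _; rewrite mxE eqxx.
have [p ab] : exists p, a p != b p.
  apply/existsP; apply: contra_neqT neq => /existsPn ab; apply/ffunP => p.
  by have := ab p; rewrite negbK => /eqP.
by rewrite /tpow (bigD1 p) //= mxE (negPf ab) mul0r.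
Qed.

Lemma map_tpow (R S : comPzRingType) (f : {rmorphism R -> S}) (I : finType) n
    (g : 'M[R]_n) (a b : {ffun I -> 'I_n}) :
  f (tpow g a b) = tpow (map_mx f g) a b.
Proof. by rewrite /tpow rmorph_prod; apply: eq_bigr => p _; rewrite mxE. Qed.

Lemma tpowZ (R : comPzRingType) (I : finType) n z (g : 'M[R]_n)
    (a b : {ffun I -> 'I_n}) : tpow (z *: g) a b = z ^+ #|I| * tpow g a b.
Proof.
rewrite /tpow -prodr_const -big_split /=.
by apply: eq_bigr => p _; rewrite mxE.
Qed.

End Tpow.

Lemma tpow_diag (R : comPzRingType) (I : finType) n (t : 'rV[R]_n)
    (a b : {ffun I -> 'I_n}) :
  tpow (diag_mx t) a b = (a == b)%:R * \prod_p t 0 (a p).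
Proof.
rewrite -tpow1 /tpow -big_split; apply: eq_bigr => p _ /=.
by rewrite !mxE; case: eqP => _; rewrite ?mul1r ?mulr0n ?mul0r ?mulr1n.
Qed.

Section FFT.
Variables (F : numFieldType) (I : finType) (n : nat).
Variable Phi : {ffun I -> 'I_n} -> {ffun I -> 'I_n} -> F.
Hypothesis Phi_comm : forall (g : 'M_n) a b, g \in unitmx ->
  \sum_c tpow g a c * Phi c b = \sum_d Phi a d * tpow g d b.

(** The relation is polynomial in [g], so it extends from invertible matrices to
    all matrices. *)
Lemma tpow_comm_all (g : 'M_n) a b :
  \sum_c tpow g a c * Phi c b = \sum_d Phi a d * tpow g d b.
Proof.
apply/eqP; rewrite -subr_eq0; apply/eqP.
pose f g := \sum_c tpow g a c * Phi c b - \sum_d Phi a d * tpow g d b.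
pose P (A : 'M[{poly F}]_n) : {poly F} :=
  \sum_c tpow A a c * (Phi c b)%:P - \sum_d (Phi a d)%:P * tpow A d b.
apply: (@big_cell_dense _ _ f P) => [A s|L U _ _ Lu Uu].
  rewrite -[LHS]/(horner_eval s (P A)) rmorphB !rmorph_sum /=.
  congr (_ - _); apply: eq_bigr => c _; rewrite rmorphM /= map_tpow /=.
    by congr (_ * _); rewrite /horner_eval hornerC.
  by congr (_ * _); rewrite /horner_eval hornerC.
by apply/eqP; rewrite subr_eq0 Phi_comm // unitmx_mul Lu.
Qed.

Variable iota : {ffun I -> 'I_n}.
Hypothesis iota_inj : injective iota.

(** Commutation with the diagonal matrices that double one coordinate says that
    [b] takes every value as often as [iota] does. *)
Lemma Phi_iota_supp b : Phi iota b != 0 -> exists s : {perm I}, b = [ffun p => iota (s p)].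
Proof.
move=> Phi_b.
have cnt i : #|[pred p | iota p == i]| = #|[pred p | b p == i]|.
  have := tpow_comm_all (diag_mx (\row_j if j == i then 2 else 1)) iota b.
  rewrite (bigD1 iota) //= big1 => [|c neq]; last first.
    by rewrite tpow_diag eq_sym (negPf neq) !mul0r.
  rewrite addr0 (bigD1 b) //= big1 => [|c neq]; last first.
    by rewrite tpow_diag (negPf neq) mul0r mulr0.
  rewrite addr0 !tpow_diag !eqxx !mul1r mulrC => /(mulfI Phi_b).
  have E (a : {ffun I -> 'I_n}) :
      \prod_p (\row_j (if j == i then 2 else 1 : F)) 0 (a p) = 2 ^+ #|[pred p | a p == i]|.
    rewrite -prodr_const [RHS]big_mkcond /=; apply: eq_bigr => p _.
    by rewrite mxE inE.
  by rewrite !E => /ieexprIn -> //; rewrite ?ltr0n // gt_eqF ?ltr1n.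
have b_inj : injective b.
  move=> p q bpq; apply/eqP; apply/negPn/negP => neq.
  have : (1 < #|[pred r | iota r == b p]|)%N.
    rewrite cnt; apply: (@leq_trans #|pred2 p q|).
      by rewrite card2 neq.
    by apply: subset_leq_card; apply/subsetP => r /pred2P[]->; rewrite inE // bpq.
  apply/negP; rewrite -leqNgt; apply/card_le1_eqP => r r'.
  by rewrite !inE => /eqP <- /eqP /iota_inj.
have ex p : exists q, iota q == b p.
  have : (0 < #|[pred r | iota r == b p]|)%N.
    by rewrite cnt; apply/card_gt0P; exists p; rewrite inE.
  by case/card_gt0P => q; exists q.
pose s0 p := xchoose (ex p).
have s0P p : iota (s0 p) = b p by apply/eqP/(xchooseP (ex p)).
have s0_inj : injective s0 by move=> p q /(congr1 iota); rewrite !s0P => /b_inj.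
by exists (perm s0_inj); apply/ffunP => p; rewrite ffunE permE s0P.
Qed.

(** First fundamental theorem of invariant theory in the stable range, where
    [iota] can be injective.  A possibly singular matrix [g] sends the generic
    index [iota] to any given index [a]; commutation with [g] then expresses the
    row of [Phi] at [a] by its row at [iota], which is known by the previous lemma. *)
Lemma stable_FFT a b :
  Phi a b = \sum_(s : {perm I}) Phi iota [ffun p => iota (s p)] *
    (b == [ffun p => a (s p)])%:R.
Proof.
(* row [iota p] of [g] is the basis vector of index [a p], the other rows vanish *)
pose g : 'M[F]_n := \matrix_(i, j)
  (if [pick p | iota p == i] is Some p then j == a p else false)%:R.
have gE p j : g (iota p) j = (j == a p)%:R.
  rewrite mxE; case: pickP => [q /eqP /iota_inj -> //|/(_ p)].
  by rewrite eqxx.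
have := tpow_comm_all g iota b.
rewrite (bigD1 a) //= big1 => [|c neq]; last first.
  rewrite [tpow _ _ _](_ : _ = tpow 1%:M c a); first by rewrite tpow1 (negPf neq) mul0r.
  by apply: eq_bigr => p _; rewrite gE !mxE.
rewrite [tpow _ _ _](_ : _ = tpow 1%:M a a); last first.
  by apply: eq_bigr => p _; rewrite gE !mxE.
rewrite tpow1 eqxx mul1r addr0 => ->.
pose h (s : {perm I}) : {ffun I -> 'I_n} := [ffun p => iota (s p)].
have h_inj : injective h.
  move=> s t /ffunP st; apply/permP => p; apply: iota_inj.
  by have := st p; rewrite !ffunE.
rewrite (bigID [pred d | d \in h @: setT]) /= addrC big1 ?add0r => [|d /negP dNh]; last first.
  have [->|/Phi_iota_supp [s ds]] := eqVneq (Phi iota d) 0; first by rewrite mul0r.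
  by case: dNh; rewrite ds; apply: (imset_f h).
rewrite big_imset /=; last by move=> s t _ _ /h_inj.
apply: eq_big => [s|s _]; first by rewrite inE.
congr (_ * _).
rewrite -tpow1; apply: eq_bigr => p _; rewrite /h !ffunE gE.
by rewrite mxE.
Qed.

End FFT.

(** * The action on mixed tensors and its hermitian form *)

Section Action.
Variables (F : fieldType) (n k : nat).
Implicit Types (g h : 'M[F]_n) (T : tensor F n k).

Lemma SL_actE g T (a b : mindex n k) :
  SL_act k g T (a, b) =
  \sum_(c : mindex n k) \sum_(d : mindex n k)
     tpow g a c * tpow (invmx g) d b * T (c, d).
Proof. by rewrite lfunE ffunE. Qed.

Lemma SL_act1 T : SL_act k 1%:M T = T.
Proof.
apply/ffunP => -[a b]; rewrite SL_actE (bigD1 a) //= [X in _ + X]big1 ?addr0 => [|c neq].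
  rewrite (bigD1 b) //= [X in _ + X]big1 ?addr0 => [|d neq].
    by rewrite invmx1 !tpow1 !eqxx !mul1r.
  by rewrite invmx1 !tpow1 (negPf neq) mulr0 mul0r.
by apply: big1 => d _; rewrite tpow1 eq_sym (negPf neq) !mul0r.
Qed.

Lemma SL_actM g h T : g \in unitmx -> h \in unitmx ->
  SL_act k g (SL_act k h T) = SL_act k (g *m h) T.
Proof.
move=> gu hu; apply/ffunP => -[a b]; rewrite !SL_actE.
have -> : invmx (g *m h) = invmx h *m invmx g.
  have ghu : g *m h \in unitmx by rewrite unitmx_mul gu.
  apply: (can_inj (mulKmx ghu)); rewrite mulmxV //.
  by rewrite mulmxA mulmxK // mulmxV.
transitivity (\sum_(c : mindex n k) \sum_(d : mindex n k)
   \sum_(c' : mindex n k) \sum_(d' : mindex n k)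
    (tpow g a c' * tpow h c' c) * (tpow (invmx h) d d' * tpow (invmx g) d' b) * T (c, d)).
  under eq_bigr => c _ do under eq_bigr => d _ do rewrite SL_actE mulr_sumr.
  under eq_bigr => c _ do under eq_bigr => d _ do
    under eq_bigr => c' _ do rewrite mulr_sumr.
  under eq_bigr => c _ do rewrite exchange_big.
  rewrite exchange_big; apply: eq_bigr => c' _.
  under eq_bigr => c _ do rewrite exchange_big.
  rewrite exchange_big; apply: eq_bigr => d' _.
  apply: eq_bigr => c _; apply: eq_bigr => d _; ring.
apply: eq_bigr => c _; apply: eq_bigr => d _.
rewrite -!tpowM mulr_suml; rewrite mulr_suml; apply: eq_bigr => c' _.
by rewrite mulr_sumr mulr_suml.
Qed.

Lemma SL_actZ z g T : z != 0 -> g \in unitmx ->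
  SL_act k (z *: g) T = SL_act k g T.
Proof.
move=> z0 gu; apply/ffunP => -[a b]; rewrite !SL_actE.
have zu : z \is a GRing.unit by rewrite unitfE.
apply: eq_bigr => c _; apply: eq_bigr => d _; congr (_ * _).
rewrite invmxZ ?unitmxZ // !tpowZ exprVn mulrACA mulfV ?mul1r //.
by rewrite expf_neq0.
Qed.

End Action.

Section Hermitian.
Variables (C : numClosedFieldType) (n k : nat).
Local Notation T := (tensor C n k).
Implicit Types (g h : 'M[C]_n) (X Y : T) (U W : {vspace T}).

Definition GL_stable W := forall g X, g \in unitmx -> X \in W -> SL_act k g X \in W.

Lemma GL_stable_SL W : GL_stable W -> SL_stable W.
Proof.
move=> Wst g g1; apply/subvP => _ /memv_imgP [X XW ->]; apply: Wst => //.
by rewrite unitmxE g1 unitr1.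
Qed.

(** Scalar matrices act trivially, and over an algebraically closed field every
    invertible matrix is a scalar multiple of one of determinant 1. *)
Lemma SL_stable_GL W : (0 < n)%N -> SL_stable W -> GL_stable W.
Proof.
move=> n0 Wst g X gu XW.
have d0 : \det g != 0 by move: gu; rewrite unitmxE unitfE.
pose z := n.-root (\det g).
have zn : z ^+ n = \det g by apply: rootCK.
have z0 : z != 0 by apply: contraNneq d0 => z0; rewrite -zn z0 expr0n gtn_eqF.
have -> : g = z *: (z^-1 *: g) by rewrite scalerA mulfV // scale1r.
have zu : z^-1 \is a GRing.unit by rewrite unitfE invr_eq0.
rewrite SL_actZ ?unitmxZ //.
have /Wst/subvP : \det (z^-1 *: g) = 1 by rewrite detZ exprVn zn mulVf.
by apply; exact: memv_img.
Qed.

Definition dot X Y : C := \sum_ab X ab * (Y ab)^*.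

Lemma dot_is_linear Y : linear (fun X : T => dot X Y : C^o).
Proof.
move=> z X X'; rewrite /dot scaler_sumr -big_split /=.
by apply: eq_bigr => ab _; rewrite !ffunE mulrDl -scalerAl.
Qed.

Lemma dotDl X X' Y : dot (X + X') Y = dot X Y + dot X' Y.
Proof. by have := dot_is_linear Y 1 X X'; rewrite !scale1r. Qed.

Lemma dot0l Y : dot 0 Y = 0.
Proof. by apply: big1 => ab _; rewrite ffunE mul0r. Qed.

Lemma dotZl z X Y : dot (z *: X) Y = z * dot X Y.
Proof. by have := dot_is_linear Y z X 0; rewrite dot0l !addr0. Qed.

Lemma dot_suml (I : Type) (r : seq I) (P : pred I) (f : I -> T) Y :
  dot (\sum_(i <- r | P i) f i) Y = \sum_(i <- r | P i) dot (f i) Y.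
Proof.
elim/big_rec2: _ => [|i y x _ <-]; first exact: dot0l.
by rewrite dotDl.
Qed.

Lemma dotC X Y : dot X Y = (dot Y X)^*.
Proof.
rewrite /dot rmorph_sum; apply: eq_bigr => ab _ /=.
by rewrite rmorphM /= conjCK mulrC.
Qed.

Lemma dot_eq0C X Y : (dot X Y == 0) = (dot Y X == 0).
Proof. by rewrite dotC conjC_eq0. Qed.

Lemma dotZr z X Y : dot X (z *: Y) = z^* * dot X Y.
Proof. by rewrite dotC dotZl rmorphM /= -dotC. Qed.

Lemma dot_self_eq0 X : dot X X = 0 -> X = 0.
Proof.
move/eqP; rewrite psumr_eq0 => [/allP X0|ab _]; last exact: mul_conjC_ge0.
apply/ffunP => ab; rewrite [RHS]ffunE; apply/eqP.
by rewrite -mul_conjC_eq0; apply: X0; rewrite mem_index_enum.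
Qed.

Lemma dotE X Y :
  dot X Y = \sum_(a : mindex n k) \sum_(b : mindex n k) X (a, b) * (Y (a, b))^*.
Proof. by rewrite pair_big; apply: eq_bigr => -[]. Qed.

Lemma tpow_conj_tr g (a b : mindex n k) :
  tpow (map_mx Num.conj g)^T a b = (tpow g b a)^*.
Proof. by rewrite /tpow rmorph_prod; apply: eq_bigr => p _; rewrite !mxE. Qed.

(** The adjoint of the action of [g] is the action of its conjugate transpose;
    this is what makes orthogonal complements of stable subspaces stable. *)
Lemma dot_SL_act g X Y :
  dot (SL_act k g X) Y = dot X (SL_act k (map_mx Num.conj g)^T Y).
Proof.
transitivity (\sum_(a : mindex n k) \sum_(b : mindex n k)
   \sum_(c : mindex n k) \sum_(d : mindex n k)
    tpow g a c * tpow (invmx g) d b * X (c, d) * (Y (a, b))^*).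
  rewrite dotE; apply: eq_bigr => a _; apply: eq_bigr => b _.
  by rewrite SL_actE mulr_suml; apply: eq_bigr => c _; rewrite mulr_suml.
under eq_bigr => a _ do rewrite exchange_big.
rewrite exchange_big dotE; apply: eq_bigr => c _.
under eq_bigr => a _ do rewrite exchange_big.
rewrite exchange_big; apply: eq_bigr => d _ /=.
rewrite SL_actE rmorph_sum mulr_sumr; apply: eq_bigr => a _ /=.
rewrite rmorph_sum mulr_sumr; apply: eq_bigr => b _ /=.
rewrite !rmorphM /= -trmx_inv -map_invmx !tpow_conj_tr !conjCK.
by ring.
Qed.

Lemma unitmx_conj_tr g : g \in unitmx -> (map_mx Num.conj g)^T \in unitmx.
Proof. by rewrite unitmx_tr map_unitmx. Qed.

Definition coords_dot W X : 'rV[C]_(\dim W) := \row_i dot X (vbasis W)`_i.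

Fact coords_dot_linear W : linear (coords_dot W).
Proof. by move=> z X Y; apply/rowP => i; rewrite !mxE dotDl dotZl. Qed.
HB.instance Definition _ W :=
  GRing.isLinear.Build C T 'rV[C]_(\dim W) *:%R (coords_dot W) (@coords_dot_linear W).

Definition perp W : {vspace T} := lker (linfun (coords_dot W)).

Lemma perpP W X : reflect (forall Y, Y \in W -> dot X Y = 0) (X \in perp W).
Proof.
rewrite memv_ker lfunE /=; apply: (iffP eqP) => [X0 Y YW|X0].
  rewrite (coord_vbasis YW) dotC dot_suml rmorph_sum big1 // => i _ /=.
  by rewrite -dotC dotZr; move/rowP/(_ i): X0; rewrite !mxE => ->; rewrite mulr0.
by apply/rowP => i; rewrite !mxE X0 // vbasis_mem // memt_nth.
Qed.

Lemma perp_cap W : (W :&: perp W = 0)%VS.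
Proof.
apply/eqP; rewrite -subv0; apply/subvP => X /memv_capP [XW /perpP X0].
by rewrite memv0; apply/eqP/dot_self_eq0/X0.
Qed.

Lemma perp_sum W : (W + perp W = fullv)%VS.
Proof.
apply/eqP; rewrite eqEdim subvf dimv_disjoint_sum ?perp_cap //.
rewrite -(limg_ker_dim (linfun (coords_dot W)) fullv) capfv addnC leq_add2r.
by apply: leq_trans (dimvS (subvf _)) _; rewrite dimvf /dim /= mul1n.
Qed.

Lemma perp_stable W : GL_stable W -> GL_stable (perp W).
Proof.
move=> Wst g X gu /perpP X0; apply/perpP => Y YW.
by rewrite dot_SL_act X0 // Wst // unitmx_conj_tr.
Qed.

Definition proj W := daddv_pi W (perp W).

Lemma proj_id W X : X \in W -> proj W X = X.
Proof. exact/daddv_pi_id/perp_cap. Qed.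

Lemma proj_mem W X : proj W X \in W.
Proof. exact: memv_pi. Qed.

Lemma proj_perp W X : X - proj W X \in perp W.
Proof.
have {1}<- := @daddv_pi_add _ _ W (perp W) X (perp_cap W).
  by rewrite [_ + _ - _]addrC addKr memv_pi.
by rewrite perp_sum memvf.
Qed.

Lemma proj_eq0 W X : X \in perp W -> proj W X = 0.
Proof.
move=> XW; apply/eqP; rewrite -memv0 -(perp_cap W) memv_cap proj_mem /=.
by rewrite -[proj W X](subKr X) rpredB // proj_perp.
Qed.

Lemma proj_comm W g X : GL_stable W -> g \in unitmx ->
  proj W (SL_act k g X) = SL_act k g (proj W X).
Proof.
move=> Wst gu; rewrite -{1}[X](subrK (proj W X)).
move: (X - proj W X) (proj_perp W X) => Y XP.
rewrite !linearD /= proj_eq0 ?add0r; last exact: (perp_stable Wst gu XP).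
by rewrite proj_id // Wst // proj_mem.
Qed.

End Hermitian.

(** * Symmetric trace-free tensors *)

Section Symmetric.
Variables (F : fieldType) (n k : nat).
Implicit Types (T : tensor F n k) (a b : mindex n k).

Lemma tensorZE z T ab : (z *: T) ab = z * T ab.
Proof. by rewrite ffunE. Qed.

Definition slot_symmetric T := forall (s : 'S_k) a b,
  T ([ffun p => a (s p)], [ffun p => b (s p)]) = T (a, b).

(** Contractions are computed with [upd], which overwrites one entry of an index,
    rather than with the insertion of an entry into a shorter index: all indices
    then have the same length. *)
Definition upd a (p : 'I_k) x : mindex n k :=
  [ffun r => if r == p then x else a r].

Definition traceless T := forall (p q : 'I_k) a b,
  \sum_x T (upd a p x, upd b q x) = 0.

Lemma insert_upd p x x' (a : mindex n k.-1) :
  insert_index p x a = upd (insert_index p x' a) p x.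
Proof.
apply/ffunP => r; rewrite !ffunE; case: eqP => [->|/eqP rp].
  by rewrite unlift_none.
by case: unliftP rp => [r' ->|->]; rewrite ?eqxx // ffunE liftK.
Qed.

Lemma upd_insert p x a : upd a p x = insert_index p x [ffun r => a (lift p r)].
Proof.
apply/ffunP => r; rewrite !ffunE; case: unliftP => [r' ->|->].
  by rewrite eq_sym (negPf (neq_lift _ _)) ffunE.
by rewrite eqxx.
Qed.

Lemma contract_traceless T : (0 < n)%N ->
  (forall p q, contract F n p q T = 0) <-> traceless T.
Proof.
move=> n0; split=> [T0 p q a b|T0 p q].
  have /ffunP/(_ ([ffun r => a (lift p r)], [ffun r => b (lift q r)])) := T0 p q.
  rewrite lfunE /= !ffunE /= => {2}<-.
  by apply: eq_bigr => x _; rewrite !upd_insert.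
apply/ffunP => -[a b]; rewrite lfunE /= !ffunE /=.
pose x0 := Ordinal n0.
rewrite -[RHS](T0 p q (insert_index p x0 a) (insert_index q x0 b)).
by apply: eq_bigr => x _; rewrite -!insert_upd.
Qed.

Lemma mem_slE (A : 'M[F]_n) : (A \in sl F n) = (\tr A == 0).
Proof. by rewrite memv_ker lfunE. Qed.

Lemma ptensor_in_tensor_power (U : {vspace 'M[F]_n}) (A : 'I_k -> 'M_n) :
  (forall p, A p \in U) -> ptensor A \in tensor_power k U.
Proof.
move=> AU.
have -> : ptensor A = \sum_(f : {ffun 'I_k -> 'I_(\dim U)})
    (\prod_p coord (vbasis U) (f p) (A p)) *: ptensor (fun p => (vbasis U)`_(f p)).
  apply/ffunP => -[a b]; rewrite ffunE sum_ffunE /=.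
  transitivity (\prod_p \sum_j coord (vbasis U) j (A p) * (vbasis U)`_j (a p) (b p)).
    apply: eq_bigr => p _; rewrite {1}(coord_vbasis (AU p)) summxE.
    by apply: eq_bigr => j _; rewrite mxE.
  rewrite bigA_distr_bigA; apply: eq_bigr => f _.
  by rewrite big_split /= !ffunE.
apply: memv_suml => f _; apply: memvZ; apply: memv_span.
by apply/imageP; exists f.
Qed.

(** The projection of gl(V) onto sl(V) along the scalar matrices. *)
Definition sl_part (A : 'M[F]_n) : 'M_n := A - (\tr A / n%:R)%:M.

Lemma mem_sl_part A : n%:R != 0 :> F -> sl_part A \in sl F n.
Proof.
move=> n0; rewrite mem_slE linearB /= mxtrace_scalar -[X in _ - X]mulr_natr.
by rewrite divfK // subrr.
Qed.

(** The left-hand side subtracts from a tensor its diagonal contraction in slot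
    [m], put back as a multiple of the identity. *)
Lemma ptensor_sl_part (A : 'I_k -> 'M[F]_n) m a b :
  ptensor A (a, b) - (a m == b m)%:R / n%:R * \sum_x ptensor A (upd a m x, upd b m x) =
  ptensor (fun p => if p == m then sl_part (A p) else A p) (a, b).
Proof.
pose c := \prod_(p | p != m) A p (a p) (b p).
have -> : \sum_x ptensor A (upd a m x, upd b m x) = \tr (A m) * c.
  rewrite mulr_suml; apply: eq_bigr => x _; rewrite ffunE (bigD1 m) //=.
  rewrite !ffunE eqxx; congr (_ * _); apply: eq_bigr => p pm.
  by rewrite !ffunE (negPf pm).
rewrite !ffunE (bigD1 m) //= [RHS](bigD1 m) //= eqxx -/c.
have -> : \prod_(p | p != m) (if p == m then sl_part (A p) else A p) (a p) (b p) = c.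
  by apply: eq_bigr => p /negPf->.
rewrite !mxE; case: (a m == b m); rewrite ?mulr1n ?mulr0n; ring.
Qed.

(** A tensor killed by the diagonal contraction of a slot is unchanged when that
    slot is projected onto sl(V).  Doing this for each slot of the expansion in
    elementary matrices exhibits the tensor as a combination of products of
    trace-free matrices. *)
Lemma traceless_tensor_power T : n%:R != 0 :> F -> traceless T ->
  T \in tensor_power k (sl F n).
Proof.
move=> n0 T0.
pose B m (cd : mindex n k * mindex n k) (p : 'I_k) : 'M[F]_n :=
  let E := delta_mx (cd.1 p) (cd.2 p) in if (p < m)%N then sl_part E else E.
(* induction on the number of slots already projected *)
have TE m : (m <= k)%N -> T = \sum_cd T cd *: ptensor (B m cd).
  elim: m => [_|m IHm mk].
    apply/ffunP => -[a b]; rewrite sum_ffunE (bigD1 (a, b)) //= big1 => [|[c d] neq].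
      rewrite tensorZE ffunE big1 ?addr0 ?mulr1 // => p _.
      by rewrite /B /= mxE !eqxx.
    rewrite tensorZE ffunE; apply/eqP; rewrite mulf_eq0; apply/orP; right.
    apply/negPn/negP => /prodf_neq0 nz; case/negP: neq; apply/eqP.
    have E p : (a p == c p) && (b p == d p).
      by have := nz p isT; rewrite /B /= mxE; case: (_ && _); rewrite ?eqxx.
    by congr pair; apply/ffunP => p; case/andP: (E p) => /eqP E1 /eqP E2.
  have {}IHm := IHm (ltnW mk).
  pose m' := Ordinal mk.
  apply/ffunP => -[a b].
  rewrite -[LHS]subr0 -[X in _ - X](mulr0 ((a m' == b m')%:R / n%:R)) -(T0 m' m' a b).
  rewrite {1}IHm sum_ffunE.
  under [X in _ - _ * X]eq_bigr => x _ do rewrite {1}IHm sum_ffunE.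
  rewrite exchange_big mulr_sumr -sumrB sum_ffunE; apply: eq_bigr => cd _ /=.
  rewrite !tensorZE.
  have -> : ptensor (B m.+1 cd) (a, b) =
      ptensor (fun p => if p == m' then sl_part (B m cd p) else B m cd p) (a, b).
    rewrite !ffunE; apply: eq_bigr => p _; rewrite /B ltnS leq_eqVlt -(inj_eq val_inj) /=.
    by case: ltngtP.
  rewrite -ptensor_sl_part mulrBr; congr (_ - _).
  rewrite [RHS]mulrCA; congr (_ * _); rewrite mulr_sumr.
  by apply: eq_bigr => x _; rewrite tensorZE.
rewrite (TE k) //; apply: memv_suml => cd _; apply: memvZ.
by apply: ptensor_in_tensor_power => p; rewrite /B ltn_ord mem_sl_part.
Qed.

Lemma mem_S0sl T : (0 < n)%N -> n%:R != 0 :> F ->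
  (T \in S0sl F n k) <-> slot_symmetric T /\ traceless T.
Proof.
move=> n0 nF0; rewrite /S0sl /sym_power !memv_cap.
split=> [/andP[/andP[_ Ts] Tt]|[Ts Tt]].
  split.
    move=> s a b; move: Ts; rewrite memvE => /subv_bigcapP/(_ s isT).
    rewrite -memvE => /fixedSpaceP; rewrite lfunE => /ffunP/(_ (a, b)).
    by rewrite ffunE.
  apply/contract_traceless => // p q.
  move: Tt; rewrite memvE => /subv_bigcapP/(_ p isT)/subv_bigcapP/(_ q isT).
  by rewrite -memvE memv_ker => /eqP.
rewrite traceless_tensor_power //=; apply/andP; split.
  rewrite memvE; apply/subv_bigcapP => s _; rewrite -memvE; apply/fixedSpaceP.
  by rewrite lfunE; apply/ffunP => -[a b]; rewrite ffunE Ts.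
rewrite memvE; apply/subv_bigcapP => p _; apply/subv_bigcapP => q _.
by rewrite -memvE memv_ker (contract_traceless T n0).2.
Qed.

End Symmetric.

(** * Kernels of equivariant endomorphisms *)

Section Join.
Variables (n k : nat).
Local Notation J := ('I_k + 'I_k)%type.

Definition join (a d : mindex n k) : {ffun J -> 'I_n} :=
  [ffun i => match i with inl p => a p | inr p => d p end].

Definition lpart (x : {ffun J -> 'I_n}) : mindex n k := [ffun p => x (inl p)].
Definition rpart (x : {ffun J -> 'I_n}) : mindex n k := [ffun p => x (inr p)].

Lemma join_parts x : join (lpart x) (rpart x) = x.
Proof. by apply/ffunP => -[] p; rewrite !ffunE. Qed.

Lemma lpart_join a d : lpart (join a d) = a.
Proof. by apply/ffunP => p; rewrite !ffunE. Qed.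

Lemma rpart_join a d : rpart (join a d) = d.
Proof. by apply/ffunP => p; rewrite !ffunE. Qed.

Lemma sum_join (R : nmodType) (f : {ffun J -> 'I_n} -> R) :
  \sum_x f x = \sum_(a : mindex n k) \sum_(d : mindex n k) f (join a d).
Proof.
rewrite pair_big /= (reindex (fun ad : mindex n k * mindex n k => join ad.1 ad.2)) //=.
exists (fun x => (lpart x, rpart x)) => [[a d] _|x _] /=.
  by rewrite lpart_join rpart_join.
exact: join_parts.
Qed.

Lemma tpow_join (R : comPzRingType) (g : 'M[R]_n) (a b c d : mindex n k) :
  tpow g (join a d) (join c b) = tpow g a c * tpow g d b.
Proof.
rewrite /tpow big_sumType /=.
by congr (_ * _); apply: eq_bigr => p _; rewrite !ffunE.
Qed.

End Join.

Section Equivariant.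
Variables (C : numClosedFieldType) (n k : nat).
Local Notation T := (tensor C n k).

Lemma tpowK (g : 'M[C]_n) (f : mindex n k -> C) d : g \in unitmx ->
  \sum_d' tpow g d d' * (\sum_d'' tpow (invmx g) d' d'' * f d'') = f d.
Proof.
move=> gu; under eq_bigr => d' _ do rewrite mulr_sumr.
rewrite exchange_big /= (bigD1 d) //= [X in _ + X]big1 ?addr0 => [|d'' neq].
  under eq_bigr => d' _ do rewrite mulrA.
  by rewrite -mulr_suml tpowM mulmxV // tpow1 eqxx mul1r.
under eq_bigr => d' _ do rewrite mulrA.
by rewrite -mulr_suml tpowM mulmxV // tpow1 eq_sym (negPf neq) mul0r.
Qed.

Lemma tpowKr (g : 'M[C]_n) (f : mindex n k -> C) b : g \in unitmx ->
  \sum_b' (\sum_b'' f b'' * tpow (invmx g) b'' b') * tpow g b' b = f b.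
Proof.
move=> gu; under eq_bigr => b' _ do rewrite mulr_suml.
rewrite exchange_big /= (bigD1 b) //= [X in _ + X]big1 ?addr0 => [|b'' neq].
  under eq_bigr => b' _ do rewrite -mulrA.
  by rewrite -mulr_sumr tpowM mulVmx // tpow1 eqxx mulr1.
under eq_bigr => b' _ do rewrite -mulrA.
by rewrite -mulr_sumr tpowM mulVmx // tpow1 (negPf neq) mulr0.
Qed.

Variable phi : 'End(T).
Hypothesis phi_comm : forall g X, g \in unitmx ->
  phi (SL_act k g X) = SL_act k g (phi X).

Definition etensor (c d : mindex n k) : T := [ffun ab => (ab == (c, d))%:R].

Lemma tensor_expand (X : T) :
  X = \sum_(c : mindex n k) \sum_(d : mindex n k) X (c, d) *: etensor c d.
Proof.
apply/ffunP => -[a b]; rewrite sum_ffunE (bigD1 a) //= [X in _ + X]big1 ?addr0 => [|c neq].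
  rewrite sum_ffunE (bigD1 b) //= [X in _ + X]big1 ?addr0 => [|d neq].
    by rewrite tensorZE ffunE eqxx mulr1.
  by rewrite tensorZE ffunE xpair_eqE andbC eq_sym (negPf neq) mulr0.
rewrite sum_ffunE big1 // => d _.
by rewrite tensorZE ffunE xpair_eqE eq_sym (negPf neq) mulr0.
Qed.

Definition kernel (a b c d : mindex n k) : C := phi (etensor c d) (a, b).

Lemma kernelE X (a b : mindex n k) :
  phi X (a, b) = \sum_(c : mindex n k) \sum_(d : mindex n k) kernel a b c d * X (c, d).
Proof.
rewrite {1}[X]tensor_expand linear_sum sum_ffunE; apply: eq_bigr => c _ /=.
rewrite linear_sum sum_ffunE; apply: eq_bigr => d _ /=.
by rewrite linearZ tensorZE mulrC.
Qed.

Lemma kernel_comm g a b c d : g \in unitmx ->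
  \sum_(d' : mindex n k) tpow (invmx g) d d' *
    (\sum_(c' : mindex n k) kernel a b c' d' * tpow g c' c) =
  \sum_(b' : mindex n k)
    (\sum_(a' : mindex n k) tpow g a a' * kernel a' b' c d) * tpow (invmx g) b' b.
Proof.
move=> gu; have /ffunP/(_ (a, b)) := phi_comm (etensor c d) gu.
rewrite kernelE SL_actE exchange_big /= => E.
transitivity (\sum_(d' : mindex n k) \sum_(c' : mindex n k)
    kernel a b c' d' * SL_act k g (etensor c d) (c', d')).
  apply: eq_bigr => d' _; rewrite mulr_sumr; apply: eq_bigr => c' _.
  rewrite SL_actE (bigD1 c) //= [X in _ + X]big1 ?addr0 => [|c'' neq].
    rewrite (bigD1 d) //= [X in _ + X]big1 ?addr0 => [|d'' neq].
      by rewrite ffunE eqxx mulr1; ring.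
    by rewrite ffunE xpair_eqE andbC (negPf neq) mulr0.
  by apply: big1 => d'' _; rewrite ffunE xpair_eqE (negPf neq) mulr0.
rewrite E exchange_big; apply: eq_bigr => b' _ /=.
by rewrite mulr_suml; apply: eq_bigr => a' _; rewrite /kernel; ring.
Qed.

(** The kernel of an endomorphism of mixed tensors has upper slots [a], [d] and
    lower slots [c], [b]; grouping them by kind instead of by input and output gives
    the kernel of an endomorphism of a tensor power of V alone. *)
Definition mixed_kernel (x y : {ffun 'I_k + 'I_k -> 'I_n}) : C :=
  kernel (lpart x) (rpart y) (lpart y) (rpart x).

(** This is [kernel_comm] after multiplication by the tensor power of [g] in the
    slots in which the inverse of [g] occurs. *)
Lemma mixed_kernel_comm (g : 'M[C]_n) x y : g \in unitmx ->
  \sum_z tpow g x z * mixed_kernel z y = \sum_z mixed_kernel x z * tpow g z y.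
Proof.
move=> gu; rewrite -(join_parts x) -(join_parts y).
move: (lpart x) (rpart x) (lpart y) (rpart y) => a d c b.
rewrite !sum_join exchange_big [RHS]exchange_big /= /mixed_kernel.
transitivity (\sum_(d' : mindex n k) tpow g d d' *
    (\sum_(a' : mindex n k) tpow g a a' * kernel a' b c d')).
  apply: eq_bigr => d' _; rewrite mulr_sumr; apply: eq_bigr => a' _.
  by rewrite tpow_join !lpart_join !rpart_join mulrAC mulrC.
transitivity (\sum_(b' : mindex n k)
    (\sum_(c' : mindex n k) kernel a b' c' d * tpow g c' c) * tpow g b' b); last first.
  apply: eq_bigr => b' _; rewrite mulr_suml; apply: eq_bigr => c' _.
  by rewrite tpow_join !lpart_join !rpart_join mulrA.
under [RHS]eq_bigr => b' _ do
  rewrite -(tpowK (fun d => \sum_(c' : mindex n k) kernel a b' c' d * tpow g c' c) d gu).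
under [RHS]eq_bigr => b' _ do
  under eq_bigr => d' _ do rewrite (kernel_comm a b' c d' gu).
under [RHS]eq_bigr => b' _ do rewrite mulr_suml.
rewrite [RHS]exchange_big /=; apply: eq_bigr => d' _.
under [RHS]eq_bigr => b' _ do rewrite -mulrA.
by rewrite -mulr_sumr (tpowKr (fun b' => \sum_(a' : mindex n k) tpow g a a' * kernel a' b' c d')).
Qed.

Hypothesis hn : (2 * k <= n)%N.

Lemma card_slots : (#|{: 'I_k + 'I_k}| <= n)%N.
Proof. by rewrite card_sum card_ord addnn -mul2n. Qed.

(** An injective index, which exists because 2k <= n. *)
Definition slot_embed : {ffun 'I_k + 'I_k -> 'I_n} :=
  [ffun i => widen_ord card_slots (enum_rank i)].

Lemma slot_embed_inj : injective slot_embed.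
Proof.
move=> i j; rewrite !ffunE => /(congr1 val) /= ij.
by apply: enum_rank_inj; apply: val_inj.
Qed.

Definition brauer_coef (s : {perm 'I_k + 'I_k}) : C :=
  mixed_kernel slot_embed [ffun p => slot_embed (s p)].

Lemma kernel_brauer a b c d : kernel a b c d =
  \sum_(s : {perm 'I_k + 'I_k})
    brauer_coef s * (join c b == [ffun p => join a d (s p)])%:R.
Proof.
have := stable_FFT mixed_kernel_comm slot_embed_inj (join a d) (join c b).
by rewrite /mixed_kernel !lpart_join !rpart_join.
Qed.

End Equivariant.

(** * The commutant on symmetric trace-free tensors *)

Section Commutant.
Variables (C : numClosedFieldType) (n k : nat).
Local Notation T := (tensor C n k).

Definition act_idx (s : 'S_k) (a : mindex n k) : mindex n k := [ffun p => a (s p)].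

Lemma act_idxM s t a : act_idx s (act_idx t a) = act_idx (s * t)%g a.
Proof. by apply/ffunP => p; rewrite !ffunE permM. Qed.

Lemma act_idx1 a : act_idx 1%g a = a.
Proof. by apply/ffunP => p; rewrite ffunE perm1. Qed.

Lemma slot_symmetricV (X : T) s a b : slot_symmetric X -> X (a, act_idx s b) = X (act_idx s^-1 a, b).
Proof.
move=> Xs; rewrite -[LHS](Xs s^-1%g); congr (X (_, _)).
by rewrite -[RHS]act_idx1 -(mulVg s) -act_idxM.
Qed.

(** The action on [X] of the walled Brauer diagram obtained by partial transposition
    from the permutation [s] of the 2k slots. *)
Definition brauer_term (s : {perm 'I_k + 'I_k}) (X : T) (a b : mindex n k) : C :=
  \sum_(c : mindex n k) \sum_(d : mindex n k)
    (join c b == [ffun p => join a d (s p)])%:R * X (c, d).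

(** The coefficient [G] forces [c p] and [d q] to agree and does not depend on
    their common value, so the sum over this value is a contraction of [X]. *)
Lemma traceless_sum (X : T) (G : mindex n k -> mindex n k -> C) (p q : 'I_k) :
  traceless X ->
  (forall c d : mindex n k, c p != d q -> G c d = 0) ->
  (forall (c d : mindex n k) x y, c p = d q -> x = y -> G (upd c p x) (upd d q y) = G c d) ->
  \sum_(c : mindex n k) \sum_(d : mindex n k) G c d * X (c, d) = 0.
Proof.
move=> Xt G0 Gu.
rewrite pair_big /= (bigID (fun cd : mindex n k * mindex n k => cd.1 p == cd.2 q)) /= addrC.
rewrite big1 ?add0r => [|[c d] /= neq]; last by rewrite G0 ?mul0r.
have [n0|n0] := posnP n.
  (* without indices there is nothing to sum *)
  apply: big1 => cd _; have := leq_ltn_trans (leq0n _) (ltn_ord (cd.1 p)).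
  by rewrite [X in (_ < X)%N]n0 ltnn.
(* group the pairs of indices that differ only in the common value *)
pose x0 := Ordinal n0.
rewrite (partition_big (fun cd : mindex n k * mindex n k => (upd cd.1 p x0, upd cd.2 q x0)) predT) //=.
apply: big1 => -[c0 d0] _.
have [/andP[/eqP cx0 /eqP dx0]|neq] := boolP ((c0 p == x0) && (d0 q == x0)); last first.
  apply: big_pred0 => -[c d] /=; apply/negP => /andP[_ /eqP[E1 E2]].
  by case/negP: neq; rewrite -E1 -E2 !ffunE !eqxx.
have updE (a : mindex n k) r (x : 'I_n) : upd (upd a r x) r (a r) = a.
  by apply/ffunP => i; rewrite !ffunE; case: eqP => [->|].
rewrite (reindex_onto (fun x => (upd c0 p x, upd d0 q x)) (fun cd => cd.1 p)) /=; last first.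
  move=> [c d] /= /andP[/eqP cd /eqP[<- <-]].
  congr pair; apply/ffunP => i; rewrite !ffunE; case: eqP => [->|] //.
under eq_bigl => x.
  have -> : (upd (upd c0 p x) p x0, upd (upd d0 q x) q x0) == (c0, d0).
    by apply/eqP; congr pair; [rewrite -cx0|rewrite -dx0]; rewrite updE.
  rewrite !ffunE !eqxx andbT /=.
  over.
rewrite /= (eq_bigr (fun x => G c0 d0 * X (upd c0 p x, upd d0 q x))) => [|x _].
  by rewrite -mulr_sumr Xt mulr0.
by rewrite Gu // cx0 dx0.
Qed.

(** The diagram joins the input slots [p] and [q], so it begins with their
    contraction. *)
Lemma brauer_term_cap (s : {perm 'I_k + 'I_k}) (X : T) a b p q : traceless X -> s (inl p) = inr q ->
  brauer_term s X a b = 0.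
Proof.
move=> Xt spq; apply: (@traceless_sum _ _ p q Xt) => [c d neq|c d x y cd <-].
  case: eqP => // /ffunP/(_ (inl p)); rewrite !ffunE spq => E.
  by rewrite E eqxx in neq.
have key i : (join (upd c p x) b i == join a (upd d q x) (s i)) =
    (join c b i == join a d (s i)).
  case: i => i; rewrite !ffunE.
    have [->|ip] := eqVneq i p; first by rewrite spq !ffunE !eqxx cd eqxx.
    case si: (s (inl i)) => [//|r]; rewrite ffunE ifN //.
    by apply: contraNneq ip => rq; move: si; rewrite rq -spq => /perm_inj[->].
  case si: (s (inr i)) => [//|r]; rewrite ffunE ifN //.
  by apply/eqP => rq; move: si; rewrite rq -spq => /perm_inj.
congr (_%:R); congr (nat_of_bool _); apply/eqP/eqP => /ffunP E; apply/ffunP => i.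
  by move/(_ i)/eqP: E; rewrite [X in _ == X]ffunE key => /eqP->; rewrite [RHS]ffunE.
by move/(_ i)/eqP: E; rewrite [X in _ == X]ffunE -key => /eqP->; rewrite [RHS]ffunE.
Qed.

(** The two kinds of slots are permuted separately, by [s1] and [s2]; the symmetry
    of [X] lets the permutation of the lower slots be moved to the upper slots. *)
Lemma brauer_term_block (s : {perm 'I_k + 'I_k}) :
  (forall p, exists q, s (inl p) = inl q) ->
  exists t : 'S_k, forall (X : T) a b, slot_symmetric X ->
    brauer_term s X a b = X (act_idx t a, b).
Proof.
move=> sl.
have [s1 s1P] := fin_all_exists sl.
have s1_inj : injective s1.
  by move=> p q E; have := s1P p; rewrite E -s1P => /perm_inj[].
have sr p : exists q, s (inr p) = inr q.
  case E: (s (inr p)) => [q|q]; last by exists q.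
  have qq' : s1 ((perm s1_inj)^-1%g q) = q by rewrite -(permE s1_inj) permKV.
  by move: E; rewrite -qq' -s1P => /perm_inj.
have [s2 s2P] := fin_all_exists sr.
have s2_inj : injective s2.
  by move=> p q E; have := s2P p; rewrite E -s2P => /perm_inj[].
exists (perm s2_inj * perm s1_inj)%g => X a b Xs.
have E c d : (join c b == [ffun p => join a d (s p)]) =
    (c == act_idx (perm s1_inj) a) && (d == act_idx (perm s2_inj)^-1 b).
  apply/eqP/andP => [/ffunP E|[/eqP-> /eqP->]].
    split; apply/eqP/ffunP => p.
      by have := E (inl p); rewrite !ffunE s1P permE.
    by have := E (inr ((perm s2_inj)^-1%g p)); rewrite !ffunE s2P -(permE s2_inj) permKV => ->.
  apply/ffunP => -[] p; rewrite !ffunE ?s1P ?s2P; first by rewrite permE.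
  by rewrite -(permE s2_inj) ffunE permK.
rewrite /brauer_term (bigD1 (act_idx (perm s1_inj) a)) //= [X in _ + X]big1 ?addr0 => [|c neq].
  rewrite (bigD1 (act_idx (perm s2_inj)^-1 b)) //= [X in _ + X]big1 ?addr0 => [|d neq].
    rewrite E !eqxx mul1r slot_symmetricV // invgK; congr (X (_, _)).
    by rewrite act_idxM.
  by rewrite E (negPf neq) andbF mul0r.
by apply: big1 => d _; rewrite E (negPf neq) mul0r.
Qed.

Lemma brauer_term_expand (s : {perm 'I_k + 'I_k}) : exists chi : 'S_k -> C,
  forall (X : T) a b, slot_symmetric X -> traceless X ->
    brauer_term s X a b = \sum_t chi t * X (act_idx t a, b).
Proof.
have [/forallP sl|/forallPn[p /existsPn sp]] :=
    boolP [forall p, exists q, s (inl p) == inl q].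
  have [p|t tP] := @brauer_term_block s.
    by have /existsP[q /eqP spq] := sl p; exists q.
  exists (fun u => (u == t)%:R) => X a b Xs _.
  rewrite tP // (bigD1 t) //= eqxx mul1r big1 ?addr0 // => u /negPf->.
  by rewrite mul0r.
exists (fun=> 0) => X a b _ Xt; rewrite big1 => [|t _]; last by rewrite mul0r.
case E: (s (inl p)) (sp) => [q|q] neq; first by have := neq q; rewrite eqxx.
exact: brauer_term_cap Xt E.
Qed.

(** The expansion in Brauer diagrams leaves one coefficient for each permutation of
    the upper slots.  Since the values are symmetric, conjugating these
    permutations does not change the result, and the coefficients may be
    averaged into a class function. *)
Lemma commutant_class_expansion (phi : 'End(T)) : (2 * k <= n)%N ->
  (forall g X, g \in unitmx -> phi (SL_act k g X) = SL_act k g (phi X)) ->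
  (forall X, slot_symmetric (phi X)) ->
  exists c : Par k -> C, forall (X : T) a b, slot_symmetric X -> traceless X ->
    phi X (a, b) = \sum_l c l * \sum_(t | cycle_type t == l) X (act_idx t a, b).
Proof.
move=> hn phi_comm phi_sym.
have [chi0 chi0P] := fin_all_exists brauer_term_expand.
pose chi t := \sum_s brauer_coef phi hn s * chi0 s t.
have chiP X a b : slot_symmetric X -> traceless X ->
    phi X (a, b) = \sum_t chi t * X (act_idx t a, b).
  move=> Xs Xt; rewrite kernelE.
  transitivity (\sum_s brauer_coef phi hn s * brauer_term s X a b).
    under eq_bigr => c _ do under eq_bigr => d _ do
      rewrite (kernel_brauer phi_comm hn) mulr_suml.
    under eq_bigr => c _ do rewrite exchange_big.
    rewrite exchange_big; apply: eq_bigr => s _ /=.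
    rewrite mulr_sumr; apply: eq_bigr => c _; rewrite mulr_sumr.
    by apply: eq_bigr => d _; rewrite mulrA.
  under eq_bigr => s _ do rewrite chi0P // mulr_sumr.
  rewrite exchange_big; apply: eq_bigr => t _ /=; rewrite mulr_suml.
  by apply: eq_bigr => s _; rewrite mulrA.
pose N : C := #|'S_k|%:R.
have N0 : N != 0 by rewrite pnatr_eq0 -lt0n; apply/card_gt0P; exists 1%g.
(* average of the coefficients over conjugation *)
pose chi' t := N^-1 * \sum_(r : 'S_k) chi (t ^ r^-1)%g.
have chi'P X a b : slot_symmetric X -> traceless X ->
    phi X (a, b) = \sum_t chi' t * X (act_idx t a, b).
  move=> Xs Xt.
  apply: (mulfI N0); rewrite mulr_sumr.
  transitivity (\sum_(r : 'S_k) phi X (a, b)).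
    by rewrite sumr_const mulr_natl.
  under eq_bigr => r _.
    rewrite -(phi_sym X r) chiP //.
    rewrite (reindex_inj (@conjg_inj _ r^-1%g)) /=.
    over.
  rewrite exchange_big; apply: eq_bigr => t _ /=.
  rewrite /chi' mulrA mulVKf // mulr_suml; apply: eq_bigr => r _.
  congr (_ * _); rewrite -/(act_idx r a) -/(act_idx r b) slot_symmetricV //.
  rewrite !act_idxM; congr (X (act_idx _ _, _)).
  by rewrite -mulgA -conjgE conjgKV.
have chi'_class s t : cycle_type s = cycle_type t -> chi' s = chi' t.
  move=> /cycle_type_conj[g gP]; congr (_ * _).
  have -> : t = (s ^ g)%g.
    by apply/permP => x; rewrite conjgE !permM gP permKV.
  rewrite [RHS](reindex_inj (mulIg g)) /=; apply: eq_bigr => r _.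
  by rewrite invMg conjgM conjgK.
exists (fun l => if [pick t | cycle_type t == l] is Some t then chi' t else 0).
move=> X a b Xs Xt; rewrite chi'P // (partition_big (@cycle_type k) predT) //=.
apply: eq_bigr => l _; rewrite mulr_sumr; apply: eq_bigr => t /eqP tl.
congr (_ * _); case: pickP => [u /eqP ul|/(_ t)]; last by rewrite tl eqxx.
by apply: chi'_class; rewrite tl ul.
Qed.

(** Each projection onto a member is given by [#|Par k|] coefficients.  With more
    members than coefficients there is a nontrivial linear relation between the
    projections; evaluating it on a nonzero vector of one member contradicts
    orthogonality. *)
Lemma orthogonal_family_bound (I : finType) (M : I -> {vspace T}) :
  (0 < n)%N -> (2 * k <= n)%N ->
  (forall i, GL_stable (M i)) -> (forall i, (M i <= S0sl C n k)%VS) ->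
  (forall i j, i != j -> (M j <= perp (M i))%VS) ->
  (forall i, M i != 0%VS) ->
  (#|I| <= #|Par k|)%N.
Proof.
move=> n0 hn Mst MS Morth Mnz.
have nF : n%:R != 0 :> C by rewrite pnatr_eq0 -lt0n.
have /fin_all_exists[c cP] i : exists c : Par k -> C,
    forall (X : T) a b, slot_symmetric X -> traceless X ->
    proj (M i) X (a, b) = \sum_l c l * \sum_(t | cycle_type t == l) X (act_idx t a, b).
  apply: commutant_class_expansion => // [g X gu|X]; first exact: proj_comm.
  have /(mem_S0sl _ n0 nF)[] // : proj (M i) X \in S0sl C n k.
  by apply: (subvP (MS i)); exact: proj_mem.
rewrite leqNgt; apply/negP => lt.
pose A : 'M[C]_(#|I|, #|Par k|) := \matrix_(i, j) c (enum_val i) (enum_val j).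
have : kermx A != 0.
  by rewrite kermx_eq0 -row_leq_rank -ltnNge; apply: leq_ltn_trans (rank_leq_col _) lt.
rewrite -nz_row_eq0; set z := nz_row _ => /eqP; apply.
have zA : z *m A = 0 by apply/sub_kermxP/nz_row_sub.
apply/rowP => j; rewrite [RHS]mxE.
have [m mM m0] : exists2 m, m \in M (enum_val j) & m != 0.
  by exists (vpick (M (enum_val j))); rewrite ?memv_pick ?vpick0.
have [ms mt] : slot_symmetric m /\ traceless m.
  by apply/(mem_S0sl _ n0 nF)/(subvP (MS (enum_val j))).
have E : \sum_i z 0 i *: proj (M (enum_val i)) m = 0.
  apply/ffunP => -[a b]; rewrite sum_ffunE [RHS]ffunE.
  under eq_bigr => i _ do rewrite tensorZE cP // mulr_sumr.
  rewrite exchange_big big1 // => l _ /=.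
  under eq_bigr => i _ do rewrite mulrA.
  rewrite -mulr_suml [X in X * _](_ : _ = 0) ?mul0r //.
  move/rowP/(_ (enum_rank l)): zA; rewrite !mxE => zA; rewrite -[RHS]zA.
  by apply: eq_bigr => i _; rewrite mxE enum_rankK.
move: E; rewrite (bigD1 j) //= big1 => [|i ij]; last first.
  rewrite proj_eq0 ?scaler0 //; apply: (subvP (Morth _ _ _)) mM.
  by rewrite (inj_eq enum_val_inj).
by rewrite addr0 proj_id // => /eqP; rewrite scaler_eq0 (negPf m0) orbF => /eqP.
Qed.

End Commutant.

(** * Highest weight vectors *)

Section Upper.
Variables (F : fieldType) (n : nat).

Definition upper (g : 'M[F]_n) := forall i j : 'I_n, (j < i)%N -> g i j = 0.

Lemma upperP (g : 'M[F]_n) : is_trig_mx g^T -> upper g.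
Proof. by move=> /is_trig_mxP gt i j ij; rewrite -(gt j i ij) mxE. Qed.

Lemma upper_diag_neq0 (g : 'M[F]_n) : upper g -> g \in unitmx -> forall i, g i i != 0.
Proof.
move=> gU; rewrite -unitmx_tr unitmxE det_trig; last first.
  by apply/is_trig_mxP => i j ij; rewrite mxE gU.
rewrite unitfE => /prodf_neq0 nz i; have := nz i isT; by rewrite mxE.
Qed.

(** Below the diagonal, the equation for the entries of the inverse times [g] is
    solved column by column. *)
Lemma upper_inv (g : 'M[F]_n) : upper g -> g \in unitmx ->
  upper (invmx g) /\ forall i, invmx g i i = (g i i)^-1.
Proof.
move=> gU gu; have nz := upper_diag_neq0 gU gu.
have E i j : \sum_l invmx g i l * g l j = (i == j)%:R.
  by have /matrixP/(_ i j) := mulVmx gu; rewrite !mxE.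
have iU : upper (invmx g).
  move=> i j; move: {2}(val j).+1 (ltnSn (val j)) => m.
  elim: m j => // m IH j jm ij.
  have := E i j; rewrite (bigD1 j) //= big1 => [|l lj]; last first.
    have [lj'|jl] := ltnP l j; last by rewrite gU ?mulr0 // ltn_neqAle jl andbT eq_sym.
    by rewrite (IH l (leq_trans lj' jm) (ltn_trans lj' ij)) mul0r.
  rewrite addr0 -(inj_eq val_inj) gtn_eqF // => /eqP.
  by rewrite mulf_eq0 (negPf (nz j)) orbF => /eqP.
split=> // i; have := E i i; rewrite (bigD1 i) //= big1 => [|l li]; last first.
  have [li'|il] := ltnP l i; first by rewrite iU ?mul0r.
  by rewrite gU ?mulr0 // ltn_neqAle il andbT eq_sym.
by rewrite addr0 eqxx => /(canRL (mulfK (nz i))) ->; rewrite mul1r.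
Qed.

End Upper.

Section Shape.
Variables (k : nat) (l : Par k).

Definition parts : seq nat := [seq val x | x <- val l].

Lemma size_parts : size parts = k.
Proof. by rewrite size_map size_tuple. Qed.

Lemma sumn_parts : sumn parts = k.
Proof.
have /andP[_ /eqP <-] := valP l.
by rewrite sumnE big_map.
Qed.

Lemma nth_parts_le i j : (i <= j)%N -> (nth 0 parts j <= nth 0 parts i)%N.
Proof.
have /andP[ps _] := valP l.
move=> ij; have [kj|jk] := leqP k j; first by rewrite nth_default ?size_parts.
have geq_tr : transitive geq by move=> a b c ba ac; apply: leq_trans ac ba.
have := sorted_leq_nth geq_tr leqnn 0%N ps; apply; rewrite ?inE ?size_map ?size_tuple //.
exact: leq_ltn_trans ij jk.
Qed.

(** The slots are the cells of the diagram, read row by row. *)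
Definition cell_row (p : 'I_k) : nat := reshape_index parts p.
Definition cell_col (p : 'I_k) : nat := reshape_offset parts p.

Lemma ltn_sumn_parts (p : 'I_k) : (p < sumn parts)%N.
Proof. by rewrite sumn_parts. Qed.

Lemma cell_row_lt p : (cell_row p < k)%N.
Proof. by rewrite -[X in (_ < X)%N]size_parts; apply/reshape_indexP/ltn_sumn_parts. Qed.

Lemma cell_col_lt p : (cell_col p < nth 0 parts (cell_row p))%N.
Proof. exact/reshape_offsetP/ltn_sumn_parts. Qed.

Lemma cell_inj p q : cell_row p = cell_row q -> cell_col p = cell_col q -> p = q.
Proof.
rewrite /cell_row /cell_col => r c; apply: val_inj.
by rewrite /= -(reshape_indexK parts p) r c reshape_indexK.
Qed.

Lemma cell_ex i c : (c < nth 0 parts i)%N -> exists2 p, cell_row p = i & cell_col p = c.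
Proof.
move=> ci; have := flatten_indexP ci; rewrite sumn_parts => lt.
by exists (Ordinal lt); rewrite /cell_row /cell_col /= ?flatten_indexKl ?flatten_indexKr.
Qed.

Lemma card_cell_row i : #|[pred p | cell_row p == i]| = nth 0 parts i.
Proof.
have lt (c : 'I_(nth 0 parts i)) : (flatten_index parts i c < k)%N.
  by rewrite -[X in (_ < X)%N]sumn_parts flatten_indexP.
pose f c := Ordinal (lt c).
have f_inj : injective f.
  move=> c d /(congr1 val) /= E; apply: val_inj.
  by rewrite /= -(flatten_indexKr (ltn_ord c)) E flatten_indexKr.
rewrite -[RHS]card_ord -(card_image f_inj); apply: eq_card => p.
rewrite inE; apply/eqP/imageP => [pi|[c _ ->]]; last by rewrite /cell_row flatten_indexKl.
have lt' : (cell_col p < nth 0 parts i)%N by rewrite -pi cell_col_lt.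
exists (Ordinal lt') => //; apply: val_inj.
by rewrite /= -pi /cell_row reshape_indexK.
Qed.

End Shape.

Section HighestWeight.
Variables (C : numClosedFieldType) (n k : nat).
Local Notation T := (tensor C n k).
Hypothesis hn : (2 * k <= n)%N.

Lemma leq_kn : (k <= n)%N.
Proof. by apply: leq_trans hn; rewrite leq_pmull. Qed.

Section Fixed.
Variable l : Par k.
Local Notation row := (cell_row l).
Local Notation col := (cell_col l).

(** The index that puts in each slot the row of its cell. *)
Definition row_idx : mindex n k := [ffun p => widen_ord leq_kn (Ordinal (cell_row_lt l p))].

Lemma row_idxE p : row_idx p = row p :> nat.
Proof. by rewrite ffunE. Qed.

Definition col_stab (s : 'S_k) := [forall p, col (s p) == col p].

Lemma col_stabP (s : 'S_k) : reflect (forall p, col (s p) = col p) (col_stab s).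
Proof. by apply: (iffP forallP) => h p; apply/eqP. Qed.

Lemma col_stab_inj (s t : 'S_k) : col_stab s -> col_stab t ->
  act_idx s row_idx = act_idx t row_idx -> s = t.
Proof.
move=> /col_stabP sc /col_stabP tc /ffunP st; apply/permP => p.
apply: (@cell_inj _ l); last by rewrite sc tc.
by have := st p; rewrite ![act_idx _ _ _]ffunE => /(congr1 val); rewrite /= !row_idxE.
Qed.

(** Coordinates of the antisymmetrisation along the columns of the basis tensor of
    index [row_idx]. *)
Definition col_alt (a : mindex n k) : C :=
  \sum_(s | col_stab s) (-1) ^+ s * (a == act_idx s row_idx)%:R.

Lemma col_altE (s : 'S_k) : col_stab s -> col_alt (act_idx s row_idx) = (-1) ^+ s.
Proof.
move=> sc; rewrite /col_alt (bigD1 s) //= eqxx mulr1 big1 ?addr0 // => t /andP[tc ts].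
case: eqP => [/col_stab_inj E|_]; last by rewrite mulr0.
by rewrite -E ?eqxx // in ts.
Qed.

Lemma col_alt_supp a : col_alt a != 0 -> exists2 s, col_stab s & a = act_idx s row_idx.
Proof.
move=> nz.
have [/existsP[s /andP[sc /eqP as_]]|/existsPn ns] :=
  boolP [exists s, col_stab s && (a == act_idx s row_idx)]; first by exists s.
rewrite /col_alt big1 ?eqxx // in nz => s sc.
by have := ns s; rewrite sc /= => /negPf ->; rewrite mulr0.
Qed.

(** In terms of minors: column by column the sum is the determinant of a submatrix
    of [g] whose columns are the first ones, as many as the column is long.  It vanishes when two
    entries of [a] in the same column agree; otherwise, [g] being upper triangular,
    all entries of [a] in a column must be among the rows of this column, so that
    [a] is a column permutation of [row_idx] and only one term survives. *)
Lemma upper_col_alt g a : upper g ->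
  \sum_c tpow g a c * col_alt c = (\prod_p g (row_idx p) (row_idx p)) * col_alt a.
Proof.
move=> gU.
have -> : \sum_c tpow g a c * col_alt c =
    \sum_(s | col_stab s) (-1) ^+ s * tpow g a (act_idx s row_idx).
  under eq_bigr => c _ do rewrite mulr_sumr.
  rewrite exchange_big; apply: eq_bigr => s _ /=.
  rewrite (bigD1 (act_idx s row_idx)) //= eqxx big1 ?addr0 => [|c /negPf->].
    by rewrite mulr1 mulrC.
  by rewrite !mulr0.
have nz s : tpow g a (act_idx s row_idx) != 0 -> forall p, (a p <= row_idx (s p))%N.
  move=> /prodf_neq0 nz p; rewrite leqNgt; apply: contraNN (nz p isT) => lt.
  by rewrite gU // ffunE.
have [/existsP[t /andP[tc /eqP at_]]|/existsPn nt] :=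
  boolP [exists t, col_stab t && (a == act_idx t row_idx)].
  rewrite at_ col_altE // (bigD1 t) //= [X in _ + X]big1 ?addr0 => [|s /andP[sc st]].
    rewrite mulrC; congr (_ * _); rewrite [RHS](reindex_inj (@perm_inj _ t)).
    by apply: eq_bigr => p _; rewrite ffunE.
  have [->|/[dup] nzs] := eqVneq (tpow g (act_idx t row_idx) (act_idx s row_idx)) 0.
    by rewrite mulr0.
  rewrite -at_ => /nz le; case/eqP: st; apply: col_stab_inj => //.
  apply/ffunP => p; apply/val_inj/eqP.
  have le' q : true -> (row_idx (t q) <= row_idx (s q)
      ?= iff (row_idx (t q) == row_idx (s q) :> nat))%N.
    by move=> _; split=> //; have := le q; rewrite at_ ffunE.
  (* the two indices have the same sum, so the inequalities between them are equalities *)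
  have [_ ] := leqif_sum le'.
  have total (u : 'S_k) : (\sum_q row_idx (u q) = \sum_q row_idx q)%N.
    by rewrite [RHS](reindex_inj (@perm_inj _ u)).
  rewrite (total t) (total s) eqxx => /esym/forall_inP/(_ p isT)/eqP E.
  by rewrite ![act_idx _ _ _]ffunE; apply/eqP.
have -> : col_alt a = 0.
  apply: contraNeq (nt 1%g) => /col_alt_supp[s sc as_].
  by have := nt s; rewrite sc as_ eqxx.
rewrite mulr0.
have [/existsP[p /existsP[q /and3P[pq /eqP cpq /eqP apq]]]|inj] :=
  boolP [exists p, exists q, [&& p != q, col p == col q & a p == a q]].
  set G := LHS.
  (* exchanging the two slots with equal entries reverses all signs *)
  suff : G = - G.
    move/eqP; rewrite -addr_eq0 -mulr2n -mulr_natr mulf_eq0 pnatr_eq0 orbF => /eqP.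
    by [].
  have at_ x : a (tperm p q x) = a x by case: tpermP => [->|->|].
  have ct x : col (tperm p q x) = col x by case: tpermP => [->|->|].
  rewrite {1}/G (reindex_inj (mulgI (tperm p q))) /= -sumrN.
  apply: eq_big => [s|s _].
    apply/col_stabP/col_stabP => sc x; last by rewrite permM sc ct.
    by have := sc (tperm p q x); rewrite permM tpermK ct.
  rewrite odd_permM odd_tperm pq signr_addb expr1 mulN1r mulNr; congr (- (_ * _)).
  rewrite /tpow (reindex_inj (@perm_inj _ (tperm p q))) /=; apply: eq_bigr => x _.
  by rewrite at_ !ffunE permM tpermK.
apply: big1 => s sc; have [->|/nz le] := eqVneq (tpow g a (act_idx s row_idx)) 0.
  by rewrite mulr0.
(* the cell at row [a p] in the column of [p] exists, because [a p] is at most some row of that column *)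
have ex p : exists q, (row q == a p) && (col q == col p).
  have [|q qr qc] := @cell_ex _ l (a p) (col p); last by exists q; rewrite qr qc !eqxx.
  apply: leq_trans (nth_parts_le l (le p)); rewrite row_idxE.
  by rewrite -(col_stabP _ sc) cell_col_lt.
pose t0 p := xchoose (ex p).
have t0P p : row (t0 p) = a p /\ col (t0 p) = col p.
  by have /andP[/eqP ? /eqP ?] := xchooseP (ex p).
have t0_inj : injective t0.
  move=> p q E; apply/eqP; apply: contraNT inj => neq.
  apply/existsP; exists p; apply/existsP; exists q; rewrite neq /=.
  have [rp cp] := t0P p; have [rq cq] := t0P q.
  by rewrite -cp -cq E eqxx -(inj_eq val_inj) /= -rp -rq E eqxx.
case/negP: (nt (perm t0_inj)); apply/andP; split.
  by apply/col_stabP => p; rewrite permE; case: (t0P p).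
apply/eqP/ffunP => p; rewrite ffunE permE; apply: val_inj.
by rewrite /= row_idxE; case: (t0P p).
Qed.

Definition rev_idx (b : mindex n k) : mindex n k := [ffun p => rev_ord (b p)].

Lemma rev_idxK : involutive rev_idx.
Proof. by move=> b; apply/ffunP => p; rewrite !ffunE rev_ordK. Qed.

(** Reversing the basis and transposing turns the action on dual vectors into the
    action on vectors. *)
Lemma upper_col_alt_rev g b : upper g ->
  \sum_d tpow g d b * col_alt (rev_idx d) =
  (\prod_p g (rev_ord (row_idx p)) (rev_ord (row_idx p))) * col_alt (rev_idx b).
Proof.
move=> gU; pose h : 'M_n := \matrix_(i, j) g (rev_ord j) (rev_ord i).
have hU : upper h.
  by move=> i j ij; rewrite mxE gU //=; apply: ltn_sub2l => //; apply: leq_ltn_trans ij _.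
transitivity ((\prod_p h (row_idx p) (row_idx p)) * col_alt (rev_idx b)); last first.
  by congr (_ * _); apply: eq_bigr => p _; rewrite mxE.
rewrite -(upper_col_alt _ hU) (reindex_inj (inv_inj rev_idxK)) /=; apply: eq_bigr => c _.
rewrite rev_idxK; congr (_ * _); apply: eq_bigr => p _.
by rewrite mxE !ffunE rev_ordK.
Qed.

Lemma act_idx_rev s b : act_idx s (rev_idx b) = rev_idx (act_idx s b).
Proof. by apply/ffunP => p; rewrite !ffunE. Qed.

Definition hw_vector : T := [ffun ab => \sum_(s : 'S_k)
  col_alt (act_idx s ab.1) * col_alt (rev_idx (act_idx s ab.2))].

Definition hw_char (g : 'M[C]_n) : C :=
  \prod_p (g (row_idx p) (row_idx p) / g (rev_ord (row_idx p)) (rev_ord (row_idx p))).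

Lemma tpow_act (g : 'M[C]_n) (s : 'S_k) (a c : mindex n k) :
  tpow g (act_idx s a) (act_idx s c) = tpow g a c.
Proof.
rewrite /tpow [RHS](reindex_inj (@perm_inj _ s)).
by apply: eq_bigr => p _; rewrite !ffunE.
Qed.

Lemma act_idx_inj (s : 'S_k) : injective (@act_idx n k s).
Proof.
by move=> a b E; rewrite -(act_idx1 a) -(act_idx1 b) -(mulVg s) -!act_idxM E.
Qed.

Lemma upper_hw_vector g : upper g -> g \in unitmx ->
  SL_act k g hw_vector = hw_char g *: hw_vector.
Proof.
move=> gU gu; have [iU id] := upper_inv gU gu.
apply/ffunP => -[a b]; rewrite SL_actE tensorZE ffunE mulr_sumr.
transitivity (\sum_(s : 'S_k) \sum_(c : mindex n k) \sum_(d : mindex n k)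
    (tpow g (act_idx s a) c * col_alt c) *
    (tpow (invmx g) d (act_idx s b) * col_alt (rev_idx d))).
  under eq_bigr => c _ do under eq_bigr => d _ do rewrite ffunE mulr_sumr.
  under eq_bigr => c _ do rewrite exchange_big.
  rewrite exchange_big; apply: eq_bigr => s _ /=.
  rewrite [RHS](reindex_inj (@act_idx_inj s)); apply: eq_bigr => c _ /=.
  rewrite [RHS](reindex_inj (@act_idx_inj s)); apply: eq_bigr => d _ /=.
  rewrite !tpow_act; ring.
apply: eq_bigr => s _; rewrite /=.
under eq_bigr => c _ do rewrite -mulr_sumr upper_col_alt_rev //.
rewrite -mulr_suml upper_col_alt // /hw_char big_split /=.
under [X in _ * (X * _) = _]eq_bigr => p _ do rewrite id.
ring.
Qed.

Lemma hw_vector_sym : slot_symmetric hw_vector.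
Proof.
move=> s a b; rewrite -/(act_idx s a) -/(act_idx s b) !ffunE /=.
rewrite [RHS](reindex_inj (mulIg s)) /=.
by apply: eq_bigr => t _; rewrite !act_idxM.
Qed.

Lemma hw_vector_supp a b : hw_vector (a, b) != 0 ->
  exists s t, a = act_idx s row_idx /\ b = rev_idx (act_idx t row_idx).
Proof.
rewrite ffunE => nz.
have [s] : exists s : 'S_k, col_alt (act_idx s a) * col_alt (rev_idx (act_idx s b)) != 0.
  apply/existsP; apply: contraNT nz => /existsPn z.
  by apply/eqP/big1 => s _; apply/eqP; have := z s; rewrite negbK.
rewrite mulf_eq0 negb_or => /andP[/col_alt_supp[t _ at_] /col_alt_supp[u _ bu]].
exists (s^-1 * t)%g, (s^-1 * u)%g; split.
  by apply: (@act_idx_inj s); rewrite at_ act_idxM mulKVg.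
apply: (@act_idx_inj s); rewrite -(rev_idxK (act_idx s b)) bu.
by rewrite act_idx_rev act_idxM mulKVg.
Qed.

(** The upper indices are among the [k] first ones and the lower indices among the
    [k] last ones; these ranges are disjoint. *)
Lemma hw_vector_traceless : traceless hw_vector.
Proof.
move=> p q a b; apply: big1 => x _; apply/eqP; apply/negPn/negP.
case/hw_vector_supp => s [t [/ffunP/(_ p) E1 /ffunP/(_ q) E2]].
move: E1 E2; rewrite !ffunE !eqxx => xs xt.
have : (x < k)%N by rewrite xs /= cell_row_lt.
rewrite ltnNge => /negP; apply.
rewrite xt /=; apply: leq_trans (leq_sub2l _ (cell_row_lt l _)).
by rewrite leq_subRL ?addnn -?mul2n // leq_kn.
Qed.

(** Its coordinate at the index pair built from [row_idx] is a sum of squares of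
    signs and zeros, and the identity permutation contributes 1. *)
Lemma hw_vector_neq0 : hw_vector != 0.
Proof.
apply/eqP => /ffunP/(_ (row_idx, rev_idx row_idx)); rewrite !ffunE /=.
pose e (s : 'S_k) := [exists t, col_stab t && (act_idx s row_idx == act_idx t row_idx)].
rewrite (eq_bigr (fun s => (e s)%:R)) => [|s _].
  rewrite -natr_sum => /eqP; rewrite pnatr_eq0 sum_nat_eq0 => /forall_inP/(_ 1%g isT).
  rewrite eqb0 => /existsP[]; exists 1%g; rewrite eqxx andbT.
  by apply/col_stabP => p; rewrite perm1.
have -> : rev_idx (act_idx s (rev_idx row_idx)) = act_idx s row_idx.
  by apply/ffunP => p; rewrite !ffunE rev_ordK.
rewrite /e; have [/existsP[t /andP[tc /eqP ->]]|/existsPn nt] := boolP (e s).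
  rewrite col_altE // -signr_addb addbb expr0.
  by case: existsP => // -[]; exists t; rewrite tc eqxx.
case: existsP => [[t ht]|_]; first by have := nt t; rewrite ht.
have [->|/col_alt_supp[t tc E]] := eqVneq (col_alt (act_idx s row_idx)) 0; first by rewrite mul0r.
by have := nt t; rewrite tc E eqxx.
Qed.

Lemma prod_row_idx (F : 'I_n -> C) :
  \prod_p F (row_idx p) = \prod_i F i ^+ nth 0 (parts l) i.
Proof.
rewrite (partition_big row_idx predT) //=; apply: eq_bigr => i _.
rewrite -card_cell_row -prodr_const; apply: eq_big => [p|p /eqP-> //].
by rewrite inE -row_idxE -(inj_eq val_inj).
Qed.

Lemma hw_vector_torus (t : 'rV[C]_n) : \prod_i t 0 i = 1 ->
  SL_act k (diag_mx t) hw_vector =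
  weight_char (part_weight n l - w0 (part_weight n l)) t *: hw_vector.
Proof.
move=> t1; have t0 i : t 0 i != 0.
  have : \prod_i t 0 i != 0 by rewrite t1 oner_neq0.
  by move/prodf_neq0; apply.
rewrite upper_hw_vector; last first.
- by rewrite unitmxE det_diag t1 unitr1.
- by move=> i j ij; rewrite mxE -(inj_eq val_inj) /= gtn_eqF.
congr (_ *: _); rewrite /hw_char big_split /=.
under eq_bigr => p _ do rewrite mxE eqxx mulr1n.
under [X in _ * X]eq_bigr => p _ do rewrite mxE eqxx mulr1n.
rewrite (prod_row_idx (fun i => t 0 i)) (prod_row_idx (fun i => (t 0 (rev_ord i))^-1)).
rewrite [X in _ * X](reindex_inj rev_ord_inj) /= -big_split; apply: eq_bigr => i _ /=.
rewrite !mxE expfzDr // rev_ordK exprVn; congr (_ * _).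
by rewrite -exprnN.
Qed.

Lemma hw_vector_unipotent g : upper_unitriangular g -> SL_act k g hw_vector = hw_vector.
Proof.
move=> gU; have dg i : g i i = 1 by rewrite gU // eqxx.
have gu : upper g by move=> i j ij; rewrite gU 1?ltnW // -(inj_eq val_inj) gtn_eqF.
rewrite upper_hw_vector // ?/hw_char.
  by rewrite big1 ?scale1r // => p _; rewrite !dg divr1.
rewrite -unitmx_tr unitmxE det_trig ?big1 ?unitr1 // => [i _|]; first by rewrite mxE dg.
by apply/is_trig_mxP => i j ij; rewrite mxE gu.
Qed.

Lemma hw_vectorP :
  highest_weight_vector (part_weight n l - w0 (part_weight n l)) hw_vector.
Proof.
by split; [exact: hw_vector_neq0|exact: hw_vector_unipotent|exact: hw_vector_torus].
Qed.

End Fixed.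

(** A coordinate at which both vectors are nonzero would give the same number of
    cells in each row. *)
Lemma dot_hw_vector l m : l != m -> dot (hw_vector l) (hw_vector m) = 0.
Proof.
move=> lm; apply: big1 => -[a b] _; apply/eqP; apply: contraNT lm.
rewrite mulf_eq0 negb_or conjC_eq0 => /andP[/hw_vector_supp[s [_ [as_ _]]]].
case/hw_vector_supp => t [_ [at_ _]].
have rows p : cell_row l (s p) = cell_row m (t p).
  have /ffunP/(_ p) : act_idx s (row_idx l) = act_idx t (row_idx m) by rewrite -as_.
  by rewrite ![act_idx _ _ _]ffunE => /(congr1 val); rewrite /= !row_idxE.
have E : parts l = parts m.
  apply: (@eq_from_nth _ 0%N); rewrite !size_parts // => i _.
  rewrite -!card_cell_row -!sum1_card (reindex_inj (@perm_inj _ s)).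
  rewrite [RHS](reindex_inj (@perm_inj _ t)); apply: eq_bigl => p.
  by rewrite !inE rows.
by apply/eqP; apply: val_inj; apply: val_inj; apply: (inj_map val_inj).
Qed.

End HighestWeight.

(** * The decomposition *)

(** A finite subfamily whose span has the largest dimension spans all. *)
Lemma finite_span (F : fieldType) (V : vectType F) (P : V -> Prop) :
  exists s : seq V, (forall x, x \in s -> P x) /\ (forall x, P x -> x \in <<s>>%VS).
Proof.
suff H m : forall s : seq V, (forall x, x \in s -> P x) ->
    (\dim {:V} - \dim <<s>> < m)%N ->
    exists s : seq V, (forall x, x \in s -> P x) /\ (forall x, P x -> x \in <<s>>%VS).
  exact: (H (\dim {:V}).+1 [::] _ (leq_subr _ _)).
elim: m => // m IH s sP dm.
have [all_in|/not_all_ex_not[x nx]] := classic (forall x, P x -> x \in <<s>>%VS).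
  by exists s.
have [Px xs] := imply_to_and _ _ nx.
apply: (IH (x :: s)) => [y|].
  by rewrite inE => /predU1P[->|/sP].
have lt : (\dim <<s>> < \dim <<x :: s>>)%N.
  rewrite ltn_neqAle dimvS ?span_cons ?addvSr // andbT.
  apply/negP => /eqP E; case: xs.
  have /eqP -> : <<s>>%VS == <<x :: s>>%VS by rewrite eqEdim span_cons -E leqnn andbT addvSr.
  by rewrite memv_span ?mem_head.
rewrite ltnS in dm; apply: leq_trans dm; apply: ltn_sub2l => //.
by apply: leq_trans lt (dimvS (subvf _)).
Qed.

Section Decomposition.
Variables (C : numClosedFieldType) (n k : nat).
Local Notation T := (tensor C n k).
Hypothesis hk : (1 <= k)%N.
Hypothesis hn : (2 * k <= n)%N.

Let n_gt0 : (0 < n)%N.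
Proof. by apply: leq_trans hn; rewrite muln_gt0. Qed.

Let nF : n%:R != 0 :> C.
Proof. by rewrite pnatr_eq0 -lt0n. Qed.

(** Acting and then contracting sums over [c] and [d] with a coefficient which,
    [g] cancelling against its inverse, forces [c p] and [d q] to be equal. *)
Lemma S0sl_stable : GL_stable (S0sl C n k).
Proof.
move=> g X gu /(mem_S0sl _ n_gt0 nF)[Xs Xt]; apply/(mem_S0sl _ n_gt0 nF); split.
  move=> s a b; rewrite !SL_actE -/(act_idx s a) -/(act_idx s b).
  rewrite (reindex_inj (@act_idx_inj n k s)); apply: eq_bigr => c _ /=.
  rewrite (reindex_inj (@act_idx_inj n k s)); apply: eq_bigr => d _ /=.
  by rewrite !tpow_act Xs.
move=> p q a b.
pose G (c d : mindex n k) := \sum_x tpow g (upd a p x) c * tpow (invmx g) d (upd b q x).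
transitivity (\sum_(c : mindex n k) \sum_(d : mindex n k) G c d * X (c, d)).
  under eq_bigr => x _ do rewrite SL_actE.
  rewrite exchange_big; apply: eq_bigr => c _ /=; rewrite exchange_big.
  by apply: eq_bigr => d _ /=; rewrite -mulr_suml.
have GE c d : G c d = (\prod_(r | r != p) g (a r) (c r)) *
    (\prod_(r | r != q) invmx g (d r) (b r)) * (d q == c p)%:R.
  have /matrixP/(_ (d q) (c p)) := mulVmx gu; rewrite !mxE => <-.
  rewrite mulr_sumr; apply: eq_bigr => x _.
  rewrite /tpow (bigD1 p) //= [X in _ * X](bigD1 q) //= !ffunE !eqxx.
  rewrite (eq_bigr (fun r => g (a r) (c r))) => [|r /negPf rp]; last by rewrite ffunE rp.
  rewrite [X in _ * (_ * X)](eq_bigr (fun r => invmx g (d r) (b r))) => [|r /negPf rq].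
    by ring.
  by rewrite ffunE rq.
apply: (@traceless_sum _ _ _ X G p q Xt) => [c d neq|c d x y cd xy].
  by rewrite GE eq_sym (negPf neq) mulr0.
rewrite !GE !ffunE !eqxx xy cd !eqxx; congr (_ * _ * _); apply: eq_bigr => r /negPf rp.
  by rewrite ffunE rp.
by rewrite ffunE rp.
Qed.

Local Notation v := (hw_vector C hn).

(** For [g] = L U with triangular factors, U scales the first vector and the adjoint
    of L scales the second one.  To have a polynomial function of [g], the
    inverse is replaced with the adjugate, which multiplies the pairing by the
    [k]-th power of the determinant. *)
Lemma hw_orbits_orthogonal l m g : l != m -> g \in unitmx ->
  dot (SL_act k g (v l)) (v m) = 0.
Proof.
move=> lm gu.
pose kap (a b c d : mindex n k) := v l (c, d) * (v m (a, b))^*.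
pose f (A : 'M[C]_n) := \sum_(a : mindex n k) \sum_(b : mindex n k)
  \sum_(c : mindex n k) \sum_(d : mindex n k)
  tpow A a c * tpow (\adj A) d b * kap a b c d.
have fE A : A \in unitmx -> f A = \det A ^+ k * dot (SL_act k A (v l)) (v m).
  move=> Au; rewrite dotE mulr_sumr; apply: eq_bigr => a _.
  rewrite mulr_sumr; apply: eq_bigr => b _.
  rewrite SL_actE mulr_suml mulr_sumr; apply: eq_bigr => c _.
  rewrite mulr_suml mulr_sumr; apply: eq_bigr => d _.
  have -> : \adj A = \det A *: invmx A.
    rewrite /invmx Au scalerA mulfV ?scale1r //.
    by move: Au; rewrite unitmxE unitfE.
  rewrite tpowZ card_ord /kap; ring.
suff f0 : f g = 0.
  move: (fE g gu) => /esym/eqP; rewrite f0 mulf_eq0 expf_eq0 => /orP[/andP[_]|/eqP//].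
  by move=> d0; move: gu; rewrite unitmxE unitfE d0.
pose P (A : 'M[{poly C}]_n) : {poly C} := \sum_(a : mindex n k) \sum_(b : mindex n k)
  \sum_(c : mindex n k) \sum_(d : mindex n k)
  tpow A a c * tpow (\adj A) d b * (kap a b c d)%:P.
apply: (@big_cell_dense _ _ f P) => [A s|L U Lt Ut Lu Uu].
  rewrite -[LHS]/(horner_eval s (P A)).
  rewrite rmorph_sum; apply: eq_bigr => a _; rewrite rmorph_sum; apply: eq_bigr => b _.
  rewrite rmorph_sum; apply: eq_bigr => c _; rewrite rmorph_sum; apply: eq_bigr => d _.
  by rewrite !rmorphM /= !map_tpow /= map_mx_adj /horner_eval !hornerC.
rewrite fE ?unitmx_mul ?Lu // -SL_actM // dot_SL_act.
rewrite (upper_hw_vector _ _ (upperP Ut)) //.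
rewrite (upper_hw_vector _ _ _ (unitmx_conj_tr Lu)) => [|i j ij].
  by rewrite dotZl dotZr dot_hw_vector ?mulr0.
by rewrite !mxE (is_trig_mxP Lt) // rmorph0.
Qed.

(** The span of the GL-orbit.  It is compared with arbitrary subspaces, not only
    with stable ones, so that it can be tested against the orthogonal of a single
    vector. *)
Lemma orbit_span_ex l : exists W : {vspace T},
  [/\ GL_stable W, v l \in W &
      forall U : {vspace T},
        (forall g, g \in unitmx -> SL_act k g (v l) \in U) -> (W <= U)%VS].
Proof.
have [s [sP Ps]] := finite_span (fun X : T => exists2 g, g \in unitmx & X = SL_act k g (v l)).
exists <<s>>%VS; split=> [g X gu Xs||U vU].
- have : (SL_act k g @: <<s>> <= <<s>>)%VS.
    rewrite limg_span; apply/span_subvP => _ /mapP[_ /sP[h hu ->] ->].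
    by apply: Ps; exists (g *m h); rewrite ?unitmx_mul ?gu ?SL_actM.
  by move/subvP; apply; apply: memv_img.
- by apply: Ps; exists 1%:M; rewrite ?unitmx1 ?SL_act1.
by apply/span_subvP => _ /sP[h hu ->]; apply: vU.
Qed.

Lemma perp_sym (U W : {vspace T}) : (U <= perp W)%VS -> (W <= perp U)%VS.
Proof.
move=> /subvP UW; apply/subvP => X XW; apply/perpP => Y /UW/perpP/(_ X XW) YX.
by apply/eqP; rewrite dot_eq0C YX.
Qed.

Lemma perpS (U W : {vspace T}) : (U <= W)%VS -> (perp W <= perp U)%VS.
Proof.
move=> /subvP UW; apply/subvP => X /perpP XW; apply/perpP => Y /UW; exact: XW.
Qed.

Lemma cap_perp_eq0 (U W : {vspace T}) : (U <= W)%VS -> (W :&: perp U)%VS = 0%VS -> U = W.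
Proof.
move=> UW WU0; apply/eqP; rewrite eqEsubv UW; apply/subvP => X XW.
suff /eqP : X - proj U X == 0 by move/subr0_eq ->; apply: proj_mem.
rewrite -memv0 -WU0 memv_cap proj_perp andbT rpredB //.
exact/(subvP UW)/proj_mem.
Qed.

Lemma GL_stable_cap (U W : {vspace T}) : GL_stable U -> GL_stable W -> GL_stable (U :&: W)%VS.
Proof.
move=> Ust Wst g X gu /memv_capP[XU XW].
by rewrite memv_cap Ust // Wst.
Qed.

(** A nonzero [N] would be one member too many for [orthogonal_family_bound]. *)
Lemma no_further_summand (M : Par k -> {vspace T}) (N : {vspace T}) :
  (forall l, GL_stable (M l)) -> (forall l, (M l <= S0sl C n k)%VS) ->
  (forall l m, l != m -> (M m <= perp (M l))%VS) -> (forall l, M l != 0%VS) ->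
  GL_stable N -> (N <= S0sl C n k)%VS -> (forall l, (N <= perp (M l))%VS) -> N = 0%VS.
Proof.
move=> Mst MS Mo M0 Nst NS No; apply/eqP/negPn/negP => N0.
have := @orthogonal_family_bound C n k _ (fun o : option (Par k) => if o is Some l then M l else N).
rewrite card_option ltnn => H; apply: notF; apply: H => //; try by case.
case=> [l|] [m|] // neq; last exact/perp_sym/No.
  by apply: Mo; apply: contraNneq neq => ->.
Qed.

Lemma S0sl_decomposition :
  exists W : Par k -> {vspace T},
    [/\ (\sum_(l : Par k) W l)%VS = S0sl C n k,
        directv (\sum_(l : Par k) W l)%VS
      & forall l : Par k,
          irreducible_of_highest_weight
            (part_weight n l - w0 (part_weight n l)) (W l)].
Proof.
have [W WP] := fin_all_exists orbit_span_ex.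
have Wst l : GL_stable (W l) by case: (WP l).
have vW l : v l \in W l by case: (WP l).
have Wmin l (U : {vspace T}) : (forall g, g \in unitmx -> SL_act k g (v l) \in U) -> (W l <= U)%VS.
  by case: (WP l) => _ _; apply.
have WS l : (W l <= S0sl C n k)%VS.
  apply: (Wmin l) => g gu; apply: S0sl_stable => //.
  by apply/(mem_S0sl _ n_gt0 nF); split; [exact: hw_vector_sym|exact: hw_vector_traceless].
have W0 l : W l != 0%VS.
  by apply/eqP => E; have := vW l; rewrite E memv0; apply/negP/hw_vector_neq0.
have Wo l m : l != m -> (W m <= perp (W l))%VS.
  move=> lm; apply: (Wmin m) => g gu; apply: perp_stable => //.
  suff /subvP/(_ _ (memv_line (v m))) : (<[v m]> <= perp (W l))%VS by [].
  apply: perp_sym; apply: (Wmin l) => h hu; apply/perpP => _ /vlineP[z ->].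
  by rewrite dotZr hw_orbits_orthogonal ?mulr0.
have Worth l m X Y : l != m -> X \in W m -> Y \in W l -> dot X Y = 0.
  by move=> lm /(subvP (Wo _ _ lm))/perpP; apply.
exists W; split.
- apply: cap_perp_eq0; first by apply/subv_sumP => l _.
  apply: (@no_further_summand W) => //; last 2 first.
  + exact: capvSl.
  + move=> l; apply: subv_trans (capvSr _ _) (perpS _).
    exact: (sumv_sup l).
  apply: GL_stable_cap; first exact: S0sl_stable.
  apply: perp_stable => g X gu /memv_sumP[u uW ->].
  rewrite linear_sum; apply: memv_sumr => l _; apply: Wst => //; exact: uW.
- apply/directv_sum_independent => u uW u0 l _; apply: dot_self_eq0.
  have := dot0l (u l); rewrite -u0 dot_suml (bigD1 l) //= big1 ?addr0 // => m ml.
  by apply: (Worth l m); rewrite 1?eq_sym ?uW.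
move=> l; split; last by exists (v l) => //; exact: hw_vectorP.
split; [exact: GL_stable_SL|exact: W0|move=> U Ust UW].
have {}Ust := SL_stable_GL n_gt0 Ust.
have [->|U0] := eqVneq U 0%VS; [by left|right].
apply: cap_perp_eq0 => //.
(* replace [W l] with [U] in the family; the rest of [W l] is then one summand too many *)
pose M m := if m == l then U else W m.
apply: (@no_further_summand M) => [m|m|m m' mm'|m|||m].
- by rewrite /M; case: eqP.
- rewrite /M; case: eqP => // _; exact: subv_trans UW (WS l).
- rewrite /M; case: (eqVneq m' l) => [m'l|_]; case: (eqVneq m l) => [ml|_].
  + by rewrite m'l ml eqxx in mm'.
  + by apply: subv_trans UW _; apply: Wo; rewrite -m'l.
  + by apply: subv_trans (Wo l m' _) (perpS UW); rewrite -ml.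
  by apply: Wo.
- by rewrite /M; case: (m == l).
- by apply: GL_stable_cap => //; apply: perp_stable.
- exact: subv_trans (capvSl _ _) (WS l).
rewrite /M; case: (eqVneq m l) => [_|ml]; first exact: capvSr.
by apply: subv_trans (capvSl _ _) (Wo _ _ ml).
Qed.

End Decomposition.

Theorem theorem5p5 (R : realType) (n k : nat) (hk : (1 <= k)%N)
    (hn : (2 * k <= n)%N) :
  exists W : Par k -> {vspace tensor (complex R) n k},
    [/\ (\sum_(l : Par k) W l)%VS = S0sl (complex R) n k,
        directv (\sum_(l : Par k) W l)%VS
      & forall l : Par k,
          irreducible_of_highest_weight
            (part_weight n l - w0 (part_weight n l)) (W l)].
Proof. exact: S0sl_decomposition. Qed.
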